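(* Let $M$ be a compact surface, $f$ an endomorphism of $M$, and $\Lambda$ a normal attractor of $f$ of degree $d>1$. Assume that $f$ has no critical points in the closure of the basin of $\Lambda$. Then: (a) the restriction of $f$ to $\Lambda$ is semiconjugate to $m_d$; (b) the restriction of $f$ to the immediate basin $B_0(\Lambda)$ is also semiconjugate to $m_d$.
   Context: $m_d:S^1\to S^1$, $m_d(z)=z^d$. A connected set $\Lambda\subset M$ is an attracting set (attractor) of $f$ if there is a neighborhood $U$ of $\Lambda$ such that $\overline{f(U)}\subset U$ and $\Lambda=\bigcap_{n\ge0}f^n(U)$. It is normal if $f$ is a local homeomorphism on $U$ and $f|_\Lambda$ is a covering of $\Lambda$. The basin of $\Lambda$ is the set of points whose forward orbits converge to $\Lambda$, and $B_0(\Lambda)$, the immediate basin, is its connected component containing $\Lambda$. A critical point is a point at which $f$ is not a local homeomorphism. Under the hypotheses it is known that $B_0(\Lambda)$ is homeomorphic to the open annulus $(0,1)\times S^1$, that $\Lambda$ has a basis of open annular neighborhoods $U$ with $\overline{f(U)}\subset U$, and that $f:B_0(\Lambda)\to B_0(\Lambda)$ is a covering map; ''degree $d$'' means that this covering has degree $d$, i.e. $f_*$ is multiplication by $d$ on $H_1(B_0(\Lambda),\mathbb{Z})\cong\mathbb{Z}$. In (b), semiconjugate means that there is a continuous $h:B_0(\Lambda)\to S^1$ with $hf=m_dh$ on $B_0(\Lambda)$ and $h_*:H_1(B_0(\Lambda),\mathbb{Z})\to H_1(S^1,\mathbb{Z})$ an isomorphism. In (a), identify $B_0(\Lambda)$ with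 $(0,1)\times S^1$, with universal covering projection $\pi(x,y)=(x,\exp(2\pi i y))$ on $(0,1)\times\mathbb{R}$; semiconjugate means that there is a continuous $h:\Lambda\to S^1$ with $hf|_\Lambda=m_dh$ which lifts to a continuous $H:\pi^{-1}(\Lambda)\to\mathbb{R}$, i.e. $h(\pi(x,y))=\exp(2\pi iH(x,y))$, satisfying $H(x,y+1)=H(x,y)\pm1$ (with constant sign). *)

(* Defs.v *)
From HB Require Import structures.
From mathcomp Require Import all_boot all_order all_algebra.
From mathcomp Require Import all_classical all_reals all_analysis.
From mathcomp Require Import complex freeg.

Set Implicit Arguments.
Unset Strict Implicit.
Unset Printing Implicit Defensive.

Import Order.TTheory GRing.Theory Num.Theory.
Import numFieldNormedType.Exports.

Local Open Scope classical_set_scope.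
Local Open Scope ring_scope.

Section PointSetTopology.
Context {X Y : topologicalType}.
Implicit Types (A : set X) (B : set Y).

(* Maps between subspaces are given by total functions on the ambient spaces;
   their values outside [A] are irrelevant. *)
Definition homeomorphism A B (p : X -> Y) :=
  [/\ {within A, continuous p}, p @` A = B &
      exists2 q : Y -> X, {within B, continuous q} &
        forall x, A x -> q (p x) = x].

Definition homeomorphic A B := exists p : X -> Y, homeomorphism A B p.

Definition local_homeo_at (f : X -> Y) (x : X) :=
  exists V : set X,
    [/\ open V, V x, open (f @` V) & homeomorphism V (f @` V) f].

Definition critical_point (f : X -> Y) (x : X) := ~ local_homeo_at f x.

(* [B `&` W] is an evenly covered neighborhood of [y] in [B]; its sheets are
   the sets [A `&` V] with [V] in [S]. *)
Definition covering_map A B (p : X -> Y) :=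
  [/\ {within A, continuous p}, p @` A = B &
      forall y, B y -> exists (W : set Y) (S : set (set X)),
        [/\ open W /\ W y,
            (forall V, S V -> open V),
            A `&` p @^-1` W = A `&` \bigcup_(V in S) V,
            (forall V V', S V -> S V' -> A `&` V `&` V' !=set0 -> V = V') &
            (forall V, S V -> homeomorphism (A `&` V) (B `&` W) p)]].

End PointSetTopology.

Definition compact_surface (R : realType) (M : topologicalType) :=
  [/\ compact [set: M], hausdorff_space M, @second_countable M &
      forall x : M, exists (V : set M) (W : set (R * R)),
        [/\ open V, V x, open W & homeomorphic V W]].

Section Dynamics.
Context {M : topologicalType}.
Implicit Types (f : M -> M) (L U : set M).

Definition attracting_nbhd f L U :=
  [/\ L `<=` interior U, closure (f @` U) `<=` U &
      L = \bigcap_n (iter n f @` U)].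

Definition normal_attractor f L :=
  [/\ connected L,
      exists2 U, attracting_nbhd f L U & forall x, U x -> local_homeo_at f x &
      covering_map L L f].

Definition basin f L : set M :=
  [set x | forall W, set_nbhs L W -> \forall n \near \oo, W (iter n f x)].

(* For a connected [L] inside its basin, all these components coincide. *)
Definition immediate_basin f L : set M :=
  \bigcup_(x in L) connected_component (basin f L) x.

End Dynamics.

Section Circle.
Context {R : realType}.

(* The complex plane is identified with [R * R]. *)
Definition circle : set (R * R) := [set z | z.1 ^+ 2 + z.2 ^+ 2 = 1].

Definition cexp (y : R) : R * R := (cos (2 * pi * y), sin (2 * pi * y)).

Definition cpow (d : nat) (z : R * R) : R * R :=
  let w := ((z.1 +i* z.2)%C : R[i]) ^+ d in (complex.Re w, complex.Im w).

Definition annulus : set (R * (R * R)) := [set` `]0, 1[ ] `*` circle.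

End Circle.

Section SingularHomology.
Context (R : realType).

Definition std_simplex n : set 'rV[R]_n.+1 :=
  [set t | (forall i, 0 <= t 0 i) /\ \sum_i t 0 i = 1].
Arguments std_simplex n : clear implicits.

Definition face_fun n (i : 'I_n.+2) (t : 'rV[R]_n.+1) : 'rV[R]_n.+2 :=
  \row_j (if unlift i j is Some k then t 0 k else 0).

Lemma face_subproof n (i : 'I_n.+2) (t : std_simplex n) :
  face_fun i (\val t) \in std_simplex n.+1.
Proof.
apply/mem_set; have /set_mem[t0 t1] := valP t; split.
  by move=> j; rewrite mxE; case: unliftP.
rewrite (bigD1_ord i) //= mxE unlift_none add0r -[RHS]t1.
by apply: eq_bigr => k _; rewrite mxE liftK.
Qed.

Definition face n (i : 'I_n.+2) (t : std_simplex n) : std_simplex n.+1 :=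
  exist _ (face_fun i (\val t)) (face_subproof i t).

Definition chain (X : topologicalType) n :=
  {freeg {classic (std_simplex n -> X)} / int}.

Definition boundary (X : topologicalType) n : chain X n.+1 -> chain X n :=
  fglift (fun s : {classic (std_simplex n.+1 -> X)} =>
    \sum_(i < n.+2) << (-1) ^+ i *g (s \o face i : {classic _}) >>).

Definition pushforward (X Y : topologicalType) n (h : X -> Y) :
    chain X n -> chain Y n :=
  fglift (fun s : {classic (std_simplex n -> X)} => << (h \o s : {classic _}) >>).

Definition chain_in (X : topologicalType) n (A : set X) (c : chain X n) :=
  forall s, s \in dom c -> continuous (s : std_simplex n -> X) /\ range s `<=` A.

Definition cycle_in (X : topologicalType) n (A : set X) (c : chain X n.+1) :=
  chain_in A c /\ boundary c = 0.

Definition homologous_in (X : topologicalType) n (A : set X)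
    (c c' : chain X n) :=
  exists2 b : chain X n.+1, chain_in A b & c - c' = boundary b.

(* The first homology group is cycles modulo boundaries; statements about
   induced maps on it are unfolded to statements about cycles up to homology. *)
Definition H1_multiplication (X : topologicalType) (A : set X)
    (f : X -> X) (d : nat) :=
  forall c : chain X 1, cycle_in A c ->
    homologous_in A (pushforward f c) (c *+ d).

Definition H1_isomorphism (X Y : topologicalType) (A : set X) (B : set Y)
    (h : X -> Y) :=
  (forall c : chain X 1, cycle_in A c ->
     homologous_in B (pushforward h c) 0 -> homologous_in A c 0) /\
  (forall c' : chain Y 1, cycle_in B c' ->
     exists2 c : chain X 1, cycle_in A c & homologous_in B (pushforward h c) c').

End SingularHomology.

Arguments std_simplex R n : clear implicits.

Section Degree.
Context (R : realType) {M : topologicalType}.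
Implicit Types (f : M -> M) (L : set M) (d : nat).

(* The degree is only defined when the immediate basin is an open annulus, so
   that its first homology group is infinite cyclic. *)
Definition attractor_degree f L d :=
  homeomorphic (@annulus R) (immediate_basin f L) /\
  H1_multiplication R (immediate_basin f L) f d.

Definition basin_semiconjugate f L d :=
  exists h : M -> R * R,
    [/\ {within immediate_basin f L, continuous h},
        (forall x, immediate_basin f L x -> circle (h x)),
        (forall x, immediate_basin f L x -> h (f x) = cpow d (h x)) &
        H1_isomorphism R (immediate_basin f L) circle h].

(* [p] is the identification of the annulus with the immediate basin. *)
Definition annulus_cover (p : R * (R * R) -> M) (z : R * R) : M :=
  p (z.1, cexp z.2).

Definition cover_preimage (p : R * (R * R) -> M) L : set (R * R) :=
  [set z | 0 < z.1 < 1 /\ L (annulus_cover p z)].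

Definition attractor_semiconjugate (p : R * (R * R) -> M) f L d :=
  exists (h : M -> R * R) (H : R * R -> R),
    [/\ {within L, continuous h} /\ (forall x, L x -> circle (h x)),
        (forall x, L x -> h (f x) = cpow d (h x)),
        {within cover_preimage p L, continuous H},
        (forall z, cover_preimage p L z -> h (annulus_cover p z) = cexp (H z)) &
        exists s : bool, forall z, cover_preimage p L z ->
          H (z.1, z.2 + 1) = H z + (-1) ^+ s].

End Degree.

(* Main.v *)
(* Let pi : (0,1) x R -> B be the universal cover of the immediate basin and F a
   lift of f to it; write F(z) = (_, t(z)). Then t(z + e) = t(z) + k for the deck
   transformation z |-> z + e, and evaluating a winding number, which vanishes on
   boundaries, on the loop y |-> pi(1/2, y) and on its image gives k = d. Hence
   t(z) - d z_2 is periodic, so it is bounded on a < z_1 < 1 - a, and every orbit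
   of B ends up over such a smaller annulus, locally uniformly in its starting
   point, because L is the intersection of a decreasing sequence of compact sets.
   So H(z) = lim (F^n z)_2 / d^n converges locally uniformly, is continuous, and
   satisfies H(F z) = d H(z) and H(z + e) = H(z) + 1. Therefore exp(2 pi i H)
   descends to h : B -> S^1 with h f = m_d h. Straight-line homotopies in the
   universal covers show that w |-> p(1/2, w) is a homotopy inverse of h, and the
   prism operator makes h an isomorphism on H_1. *)
From HB Require Import structures.
Require Import Defs.
From mathcomp Require Import all_boot all_order all_algebra.
From mathcomp Require Import all_classical all_reals all_analysis.
From mathcomp Require Import complex freeg ring lra zify.

Set Implicit Arguments.
Unset Strict Implicit.
Unset Printing Implicit Defensive.

Import Order.TTheory GRing.Theory Num.Theory.
Import numFieldNormedType.Exports.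

Local Open Scope classical_set_scope.
Local Open Scope ring_scope.

(* [pushforward] is also the name of the image measure in MathComp-Analysis. *)
Local Notation pushforward := Defs.pushforward.

(** * Trigonometry of the circle *)

(** The obstacle is that the displacement t(z) - d z_2 may blow up at both ends of the annulus, so H
    cannot be found as the fixed point of a contraction in a sup norm over the whole strip. Written
    as a series, H is z_2 plus the sum over n of the displacement at F^n z divided by d^(n+1). The
    terms before an orbit enters the smaller annulus are uncontrolled, but they are finitely many
    and continuous; the later ones are geometrically small. Continuity of H therefore hinges on an
    entry time that is locally constant.

    All lifting rests on one statement: a homotopy into the circle that starts at a constant map
    lifts to the line. Precomposing a map with a contraction of its domain, a cone in a simplex or
    segments in the strip, produces such a homotopy.

    The degree is given only through cycles up to homology, so k = d has to be read off by an
    additive function of chains. For this reason the winding is defined on every path, closed or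
    not, with real values.

    Part (a) uses the same h and H, restricted to the attractor; the construction can be carried out
    for any identification p. *)

Section CircleTrigonometry.
Context {R : realType}.
Implicit Types (y : R) (z w : R * R).

(* The quotient [z / w] of two points of the circle, as [z] times the conjugate
   of [w]. *)
Definition cdiv z w : R * R :=
  (z.1 * w.1 + z.2 * w.2, z.2 * w.1 - z.1 * w.2).

(* A logarithm on the right half of the circle. *)
Definition carg z : R := asin z.2 / (2 * pi).

Lemma twopi_neq0 : 2 * pi != 0 :> R.
Proof. by rewrite mulf_neq0 // gt_eqF // pi_gt0. Qed.

Lemma cexp_circle y : circle (cexp y).
Proof. exact: cos2Dsin2. Qed.

Lemma cexpD (a b : R) : cexp (a + b) =
  ((cexp a).1 * (cexp b).1 - (cexp a).2 * (cexp b).2,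
   (cexp a).2 * (cexp b).1 + (cexp a).1 * (cexp b).2) :> R * R.
Proof. by rewrite /cexp mulrDr cosD sinD /=. Qed.

Lemma circle_bound2 z : circle z -> -1 <= z.2 <= 1.
Proof. by rewrite /circle /= => h; apply/andP; split; nra. Qed.

Lemma cargK z : circle z -> 0 <= z.1 -> cexp (carg z) = z.
Proof.
case: z => a b cz a0; have b1 := circle_bound2 cz.
rewrite /cexp /carg /= mulrC divfK ?twopi_neq0// asinK ?in_itv//= cos_asin//.
move: cz; rewrite /circle /= => cz.
by rewrite -[1]cz addrK sqrtr_sqr ger0_norm.
Qed.

Lemma cexp_surj z : circle z -> exists y, cexp y = z.
Proof.
move=> cz; have [z0|z0] := leP 0 z.1; first by exists (carg z); exact: cargK.
have cz' : circle (- z.1, - z.2) by rewrite /circle /= !sqrrN.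
have z0' : 0 <= (- z.1, - z.2).1 by rewrite /= oppr_ge0 ltW.
have := cargK cz' z0'; set a := carg _ => ea.
(* Half a turn leads from the antipode, which lies in the right half, back to [z]. *)
exists (a + 1 / 2); have -> : cexp (a + 1 / 2) = (- (cexp a).1, - (cexp a).2).
  rewrite /cexp mulrDr; have -> : 2 * pi * (1 / 2) = pi :> R by field.
  by rewrite cosDpi sinDpi.
by rewrite ea /= !opprK; case: (z).
Qed.

Lemma cexp1 y : cexp (y + 1) = cexp y.
Proof.
rewrite /cexp mulrDr mulr1 mulrC.
by rewrite [2 * pi]mulrC mulr_natr (mulrC y) cosD2pi sinD2pi.
Qed.

Lemma cexp0 : cexp (0 : R) = (1, 0).
Proof. by rewrite /cexp mulr0 cos0 sin0. Qed.

Lemma cexp_nat y n : cexp (y + n%:R) = cexp y.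
Proof.
by elim: n => [|n IHn]; rewrite ?addr0// -[in LHS]natr1 addrA cexp1.
Qed.

Lemma cexp_int y (n : int) : cexp (y + n%:~R) = cexp y.
Proof.
case: n => n; first exact: cexp_nat.
by rewrite -[in RHS](subrK n.+1%:R y) cexp_nat NegzE mulrNz.
Qed.

Lemma cexp_eq1 y : cexp y = (1, 0) -> exists n : int, y = n%:~R.
Proof.
move=> ey; exists (Num.floor y); set n := Num.floor y.
have /andP[ny yn] := real_floor_itv (num_real y).
have /(congr1 fst) := cexp_int (y - n%:~R) n; rewrite subrK ey /=.
have /andP[] : 0 <= y - n%:~R < 1.
  by rewrite subr_ge0 ny ltrBlDl -/n; move: yn; rewrite intrD.
move=> u0 u1 cu; suff : y - n%:~R = 0 by move/eqP; rewrite subr_eq0 => /eqP.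
move: (y - _) u0 u1 cu => u u0 u1.
have [//|un0] := eqVneq u 0.
have pi0 := pi_gt0 R; have ugt0 : 0 < u by rewrite lt_def un0.
(* The contradiction comes from cos(2 pi u) = 1 - 2 sin(pi u)^2, which is below 1 for 0 < u < 1. *)
have : 0 < sin (pi * u) by apply: sin_gt0_pi; apply/andP; split; nra.
have -> : 2 * pi * u = (pi * u) *+ 2 by rewrite mulr2n; ring.
rewrite cos_mulr2n cos2sin2; nra.
Qed.

Lemma cexp_inj (a b : R) : cexp a = cexp b -> exists n : int, a = b + n%:~R.
Proof.
move=> eab; have [n en] : exists n : int, a - b = n%:~R; last first.
  by exists n; rewrite -en addrC subrK.
apply: cexp_eq1; rewrite cexpD eab {2 4 6 8}/cexp mulrN cosN sinN /= -/(cexp b).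
have := cexp_circle b; rewrite /circle /= => cb.
by congr (_, _); last ring; rewrite mulrN opprK -!expr2.
Qed.

Lemma cdiv_circle z w : circle z -> circle w -> circle (cdiv z w).
Proof.
rewrite /circle /cdiv /= => cz cw; rewrite -[1]mulr1 -{1}cz -cw; ring.
Qed.

Lemma cdivzz z : circle z -> cdiv z z = (1, 0).
Proof.
by rewrite /circle /cdiv /= => <-; congr (_, _); rewrite ?expr2//; ring.
Qed.

Lemma cexp_carg z w y : circle z -> circle w -> 0 <= (cdiv z w).1 ->
  cexp y = w -> cexp (y + carg (cdiv z w)) = z.
Proof.
move=> cz cw r0 yw; rewrite cexpD cargK ?yw//; last exact: cdiv_circle.
case: z w cz cw {r0 yw} => a b [c e]; rewrite /circle /cdiv /= => cz cw.
by congr (_, _); [rewrite -[RHS]mulr1|rewrite -[RHS]mulr1]; rewrite -cw; ring.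
Qed.

Lemma carg1 : carg (1, 0) = 0.
Proof.
rewrite /carg /= -[X in asin X](@sin0 R) sinK ?mul0r// in_itv/=.
by have := pi_gt0 R => ?; apply/andP; split; lra.
Qed.

Lemma cvg_pair_nbhs (T : Type) (U V : topologicalType) (F : set_system T)
    {FF : Filter F} (f : T -> U) (g : T -> V) (a : U) (b : V) :
  f x @[x --> F] --> a -> g x @[x --> F] --> b ->
  (f x, g x) @[x --> F] --> (a, b).
Proof. exact: (@cvg_pair _ _ _ F (nbhs a) (nbhs b)). Qed.

Lemma cvg_for (T : Type) (U V : topologicalType) (F : set_system T)
    {FF : Filter F} (f : T -> U) (g : U -> V) (a : U) :
  f x @[x --> F] --> a -> {for a, continuous g} -> g (f x) @[x --> F] --> g a.
Proof. by move=> fa ga; apply: (cvg_comp _ _ fa ga). Qed.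

Lemma continuous_cexp : continuous (@cexp R).
Proof.
move=> y; have cm : 2 * pi * x @[x --> y] --> 2 * pi * y.
  by apply: cvgM; [exact: cvg_cst|exact: cvg_id].
by apply: cvg_pair_nbhs; [exact: (cvg_comp _ _ cm (@continuous_cos R _))|
  exact: (cvg_comp _ _ cm (@continuous_sin R _))].
Qed.

Lemma cvg_proj1 (T : Type) (U V : topologicalType) (F : set_system T) {FF : Filter F}
    (g : T -> U * V) (a : U * V) :
  g x @[x --> F] --> a -> (g x).1 @[x --> F] --> a.1.
Proof. by case: a => a b h; apply: cvg_comp h _; exact: cvg_fst. Qed.

Lemma cvg_proj2 (T : Type) (U V : topologicalType) (F : set_system T) {FF : Filter F}
    (g : T -> U * V) (a : U * V) :
  g x @[x --> F] --> a -> (g x).2 @[x --> F] --> a.2.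
Proof. by case: a => a b h; apply: cvg_comp h _; exact: cvg_snd. Qed.

Lemma cvg_cdiv (T : Type) (F : set_system T) {FF : Filter F}
    (f g : T -> R * R) (a b : R * R) :
  f x @[x --> F] --> a -> g x @[x --> F] --> b ->
  cdiv (f x) (g x) @[x --> F] --> cdiv a b.
Proof.
move=> fa gb.
have [fa1 fa2] := (cvg_proj1 fa, cvg_proj2 fa).
have [gb1 gb2] := (cvg_proj1 gb, cvg_proj2 gb).
by apply: cvg_pair_nbhs; [apply: cvgD|apply: cvgB]; exact: cvgM.
Qed.

Lemma cvg_carg (T : Type) (F : set_system T) {FF : Filter F} (f : T -> R * R) z :
  circle z -> 0 < z.1 -> f x @[x --> F] --> z ->
  carg (f x) @[x --> F] --> carg z.
Proof.
move=> cz z0 fz; apply: cvgM; last exact: cvg_cst.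
apply: continuous_cvg; last exact: cvg_proj2.
apply: continuous_asin; move: cz; rewrite /circle /= => cz.
by apply/andP; split; nra.
Qed.

Lemma cpow_cexp d y : cpow d (cexp y) = cexp (d%:R * y).
Proof.
elim: d => [|d IHd]; first by rewrite mul0r cexp0 /cpow expr0.
have -> : d.+1%:R * y = d%:R * y + y by rewrite -natr1 mulrDl mul1r.
rewrite cexpD -IHd /cpow exprSr; move: (_ ^+ d) => [a b] /=.
by congr (_, _); ring.
Qed.

(** This is the uniqueness half of covering theory: two lifts of the same path differ by such a
    function. *)
Lemma int_valued_constant (t : R -> R) :
  {within `[0, 1], continuous t} ->
  (forall s, 0 <= s <= 1 -> exists n : int, t s = n%:~R) -> t 0 = t 1.
Proof.
move=> ct ti; have [n0 e0] : exists n : int, t 0 = n%:~R.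
  by apply: ti; rewrite lexx ler01.
have [n1 e1] : exists n : int, t 1 = n%:~R by apply: ti; rewrite lexx ler01.
have [//|t01] := eqVneq (t 0) (t 1); exfalso.
(* [m] is the smaller of the two end values, so [m + 1/2] lies between them and is attained,
   although it is no integer. *)
have [m [mmin mmax]] : exists m : int,
    (t 0 <= m%:~R \/ t 1 <= m%:~R) /\ (m%:~R + 1 <= t 0 \/ m%:~R + 1 <= t 1).
  move: t01; rewrite e0 e1 eqr_int.
  case: (ltgtP n0 n1) => // n01 _; [exists n0|exists n1];
    rewrite -[1 in X in _ /\ X]/(1%:~R) -!intrD !ler_int; lia.
have [n nE] : exists n : int, m%:~R + 1 / 2 = n%:~R :> R.
  have [|c] := @IVT R t 0 1 (m%:~R + 1 / 2) ler01 ct.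
    rewrite ge_min le_max; apply/andP; split; apply/orP.
      by case: mmin; [left|right]; lra.
    by case: mmax; [left|right]; lra.
  by rewrite in_itv/= => c01 <-; exact: ti.
have : (m < n) by rewrite -(ltr_int R) -nE; lra.
have : (n < m + 1) by rewrite -(ltr_int R) intrD -nE; lra.
lia.
Qed.

End CircleTrigonometry.

(** * Lifting homotopies to the real line *)

Section HomotopyLifting.
Context {R : realType} (X : topologicalType) (D : set X).
Variables (G : X * R -> R * R) (t0 : R).
Hypothesis openD : open D.
Hypothesis contG : forall x (s : R), D x -> 0 <= s <= 1 -> {for (x, s), continuous G}.
Hypothesis circG : forall x (s : R), D x -> 0 <= s <= 1 -> circle (G (x, s)).
Hypothesis G0 : forall x, D x -> G (x, 0) = cexp t0.

Let step N (y : X) (s : R) (k : nat) : R :=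
  carg (cdiv (G (y, s * (k.+1%:R / N.+1%:R))) (G (y, s * (k%:R / N.+1%:R)))).

(** The subdivision cuts [[0, s]], not [[0, 1]], into [N.+1] pieces. With all pieces summed this is
    a function of [s] that starts at [t0], that is, the lifted path itself. *)
Let sublift N (y : X) (s : R) (n : nat) : R := t0 + \sum_(k < n) step N y s k.

(** A positive first coordinate puts the quotient in the half circle where [carg] inverts [cexp].
    Here [s + e] may exceed 1; this is harmless because [G] is continuous from both sides at time
    1. *)
Let fine N (y : X) := forall s e : R, 0 <= s <= 1 -> 0 <= e <= N.+1%:R^-1 ->
  0 < (cdiv (G (y, s + e)) (G (y, s))).1.

Let fraction_itv (s : R) (k N : nat) : 0 <= s <= 1 -> (k <= N.+1)%N ->
  0 <= s * (k%:R / N.+1%:R) <= 1.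
Proof.
move=> /andP[s0 s1] kN; rewrite mulr_ge0 ?divr_ge0//=.
by rewrite mulr_ile1 ?divr_ge0// ler_pdivrMr// mul1r ler_nat.
Qed.

Let fineE N y (s : R) k : fine N y -> 0 <= s <= 1 -> (k < N.+1)%N ->
  0 < (cdiv (G (y, s * (k.+1%:R / N.+1%:R))) (G (y, s * (k%:R / N.+1%:R)))).1.
Proof.
move=> fN s01 kN.
have -> : s * (k.+1%:R / N.+1%:R) = s * (k%:R / N.+1%:R) + s / N.+1%:R.
  by rewrite -natr1; field.
apply: fN; first by rewrite fraction_itv// ltnW.
case/andP: s01 => s0 s1; rewrite divr_ge0//=.
by rewrite ler_piMl.
Qed.

(* Compactness of the unit interval gives one subdivision that works for all
   points near [x]. The lifts built from different subdivisions agree because a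
   path has at most one lift starting at [t0]. *)
Let near_fine x : D x -> exists N, \forall y \near x, fine N y.
Proof.
move=> Dx; pose P (i : X * R) (s : R) :=
  0 < (cdiv (G (i.1, s + i.2)) (G (i.1, s))).1.
have [[A B] /= [Ax B0] AB] : \forall i \near (x, 0 : R), `[(0 : R), 1]%classic `<=` P i.
  have /compact_near_coveringP cov := @segment_compact R 0 1.
  suff key (s : R) : 0 <= s <= 1 -> \forall s' \near s & i \near (x, 0 : R), P i s'.
    by apply: (cov _ (nbhs (x, 0 : R)) P) => s; rewrite /= in_itv/=; exact: key.
  move=> s01.
  have c1 : i.1 @[i --> filter_prod (nbhs s) (nbhs (x, 0 : R))] --> s.
    exact: cvg_fst.
  have c2 : i.2 @[i --> filter_prod (nbhs s) (nbhs (x, 0 : R))] --> (x, 0 : R).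
    exact: cvg_snd.
  have Gs (u : R * (X * R) -> R) :
      u i @[i --> filter_prod (nbhs s) (nbhs (x, 0 : R))] --> s ->
      G (i.2.1, u i) @[i --> filter_prod (nbhs s) (nbhs (x, 0 : R))] --> G (x, s).
    move=> us; exact: (cvg_for (cvg_pair_nbhs (cvg_proj1 c2) us) (contG Dx s01)).
  have cG : cdiv (G (i.2.1, i.1 + i.2.2)) (G (i.2.1, i.1))
     @[i --> filter_prod (nbhs s) (nbhs (x, 0 : R))] --> ((1, 0) : R * R).
    rewrite -(cdivzz (circG Dx s01)); apply: cvg_cdiv; apply: Gs => //.
    have : i.1 + i.2.2 @[i --> filter_prod (nbhs s) (nbhs (x, 0 : R))] --> s + 0.
      exact: (cvgD c1 (cvg_proj2 c2)).
    by rewrite addr0.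
  exact: (cvgr_gt _ (cvg_proj1 cG) _ ltr01).
have [e /= e0 eB] := B0.
have [N _ /(_ N (leqnn N)) /= Ne] := near_infty_natSinv_lt (PosNum e0).
exists N; apply: filterS Ax => y Ay s d s01 /andP[d0 dN].
apply: (AB (y, d)); last by rewrite /= in_itv.
split => //=; apply: eB; rewrite /= sub0r normrN ger0_norm//.
exact: le_lt_trans Ne.
Qed.

Let sublift_cexp N y (s : R) n : D y -> fine N y -> 0 <= s <= 1 -> (n <= N.+1)%N ->
  cexp (sublift N y s n) = G (y, s * (n%:R / N.+1%:R)).
Proof.
move=> Dy fN s01; elim: n => [|n IHn] nN.
  by rewrite /sublift big_ord0 addr0 mul0r mulr0 G0.
rewrite /sublift big_ord_recr /= addrA; apply: cexp_carg.
- exact/circG/fraction_itv.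
- by apply/circG/fraction_itv/ltnW.
- exact/ltW/fineE.
- exact/IHn/ltnW.
Qed.

Let sublift_cvg N y (s : R) n (T : Type) (F : set_system T) {FF : Filter F} u v :
  D y -> fine N y -> 0 <= s <= 1 -> (n <= N.+1)%N ->
  u i @[i --> F] --> y -> v i @[i --> F] --> s ->
  sublift N (u i) (v i) n @[i --> F] --> sublift N y s n.
Proof.
move=> Dy fN s01 + uy vs; elim: n => [|n IHn] nN.
  by rewrite /sublift; under eq_cvg do rewrite big_ord0; rewrite big_ord0; exact: cvg_cst.
rewrite /sublift; under eq_cvg do rewrite big_ord_recr/= addrA.
rewrite big_ord_recr/= addrA; apply: cvgD; first exact/IHn/ltnW.
have Gcvg k : (k <= N.+1)%N ->
    G (u i, v i * (k%:R / N.+1%:R)) @[i --> F] --> G (y, s * (k%:R / N.+1%:R)).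
  move=> kN; apply: (cvg_for _ (contG Dy (fraction_itv s01 kN))).
  by apply: cvg_pair_nbhs => //; apply: cvgM => //; exact: cvg_cst.
apply: cvg_carg; last by apply: cvg_cdiv; [exact: Gcvg|exact/Gcvg/ltnW].
- by apply: cdiv_circle; apply/circG/fraction_itv => //; exact: ltnW.
- exact: fineE.
Qed.

Let path_lift y (v : R) := exists t : R -> R,
  [/\ {within `[0, 1], continuous t},
      forall s, 0 <= s <= 1 -> cexp (t s) = G (y, s), t 0 = t0 & t 1 = v].

Let path_lift_unique y v v' : path_lift y v -> path_lift y v' -> v = v'.
Proof.
move=> [t [ct et tt0 <-]] [t' [ct' et' tt0' <-]].
apply/eqP; rewrite -subr_eq0 -[X in _ == X](subrr t0) -{1}tt0 -tt0'; apply/eqP/esym.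
apply: (@int_valued_constant R (fun s => t s - t' s)).
  by move=> s; apply: cvgB; [exact: ct|exact: ct'].
move=> s s01; have [|n ->] := @cexp_inj R (t s) (t' s); first by rewrite et ?et'.
by exists n; rewrite addrAC subrr add0r.
Qed.

Let sublift_path N y : D y -> fine N y -> path_lift y (sublift N y 1 N.+1).
Proof.
move=> Dy fN; exists (fun s => sublift N y s N.+1); split => //.
- apply/subspace_continuousP => s; rewrite /= in_itv/= => s01.
  by apply: sublift_cvg => //; [exact: cvg_cst|exact: cvg_within].
- by move=> s s01; rewrite sublift_cexp// divff ?mulr1// pnatr_eq0.
- rewrite /sublift big1 ?addr0// => k _; rewrite /step !mul0r.
  by rewrite cdivzz ?carg1//; apply: circG; rewrite ?lexx ?ler01.
Qed.

(** The value at [x] is the end of the lifted path over [x], which does not mention a subdivision.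
    Near [x] it agrees with [sublift] for one fixed [N], and continuity is read off there. *)
Lemma homotopy_lift : exists2 t : X -> R,
  forall x, D x -> {for x, continuous t} & forall x, D x -> cexp (t x) = G (x, 1).
Proof.
pose t x : R := xget 0 [set v | path_lift x v].
have tE x N : D x -> fine N x -> t x = sublift N x 1 N.+1.
  move=> Dx fN; apply: xget_unique; first exact: sublift_path.
  by move=> v vl; apply: path_lift_unique vl _; exact: sublift_path.
have i01 : 0 <= (1 : R) <= 1 by rewrite ler01 lexx.
exists t => x Dx; have [N fN] := near_fine Dx.
  have fx := nbhs_singleton fN.
  suff : t y @[y --> x] --> t x by []; rewrite [X in _ --> X](tE _ _ Dx fx).
  apply: (@cvg_trans _ (sublift N y 1 N.+1 @[y --> x])).
    apply: near_eq_cvg; near=> y; apply/esym/tE; last by near: y.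
    by near: y; exact: open_nbhs_nbhs.
  by apply: sublift_cvg => //; exact: cvg_cst.
have fx := nbhs_singleton fN.
by rewrite (tE _ _ Dx fx) sublift_cexp// divff ?mulr1// pnatr_eq0.
Unshelve. all: by end_near. Qed.

End HomotopyLifting.

(** * Singular 1-chains: homotopy invariance and winding numbers *)

Section FreeGroupLift.
Context {K : choiceType}.

Lemma fgliftB (V : lmodType int) (g : K -> V) : additive (fglift g).
Proof. exact: lift_is_additive. Qed.

HB.instance Definition _ (V : lmodType int) (g : K -> V) :=
  GRing.isAdditive.Build {freeg K / int} V (fglift g) (@fgliftB V g).

Lemma scale_freegU (a k : int) (x : K) : a *: << k *g x >> = << a * k *g x >>.
Proof. by apply/eqP/freeg_eqP => y /=; rewrite coeffZ !coeffU mulrA. Qed.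

Lemma eq_additive_freeg (V : zmodType) (u v : {additive {freeg K / int} -> V}) :
  (forall k x, u << k *g x >> = v << k *g x >>) -> u =1 v.
Proof.
move=> uv c; rewrite -(freeg_sumE c) !raddf_sum.
by apply: eq_bigr => x _; exact: uv.
Qed.

End FreeGroupLift.

Section Chains.
Context {R : realType}.

HB.instance Definition _ (X : topologicalType) n :=
  GRing.isAdditive.Build (chain R X n.+1) (chain R X n) (@boundary R X n)
    (fgliftB _).

HB.instance Definition _ (X Y : topologicalType) n (h : X -> Y) :=
  GRing.isAdditive.Build (chain R X n) (chain R Y n) (@pushforward R X Y n h)
    (fgliftB _).

Lemma boundaryU (X : topologicalType) n k (s : {classic (std_simplex R n.+1 -> X)}) :
  boundary << k *g s >> =
  \sum_(i < n.+2) << k * (-1) ^+ i *g (s \o face i : {classic _}) >>.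
Proof.
rewrite /boundary liftU scaler_sumr; apply: eq_bigr => i _.
by rewrite scale_freegU.
Qed.

Lemma pushforwardU (X Y : topologicalType) n k (s : {classic (std_simplex R n -> X)}) (h : X -> Y) :
  pushforward h << k *g s >> = << k *g (h \o s : {classic _}) >>.
Proof. by rewrite /Defs.pushforward liftU scale_freegU mulr1. Qed.

Section Maps.
Context {X Y : topologicalType}.

Lemma boundary_pushforward n (h : X -> Y) (c : chain R X n.+1) :
  boundary (pushforward h c) = pushforward h (boundary c).
Proof.
apply: (@eq_additive_freeg _ _ (@boundary R Y n \o pushforward h)
  (pushforward h \o @boundary R X n)) => k s /=.
rewrite pushforwardU !boundaryU raddf_sum /=.
by apply: eq_bigr => i _; rewrite pushforwardU.
Qed.

Lemma pushforward_comp n (Z : topologicalType) (h : X -> Y) (g : Y -> Z)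
    (c : chain R X n) :
  pushforward (g \o h) c = pushforward g (pushforward h c).
Proof.
apply: (@eq_additive_freeg _ _ (pushforward (g \o h))
  (pushforward g \o pushforward h)) => k s /=.
by rewrite !pushforwardU.
Qed.

Implicit Types (A : set X) (B : set Y).

Lemma chain_inD n A (c c' : chain R X n) :
  chain_in A c -> chain_in A c' -> chain_in A (c + c').
Proof.
by move=> Ac Ac' s /domD_subset; rewrite mem_cat => /orP[/Ac|/Ac'].
Qed.

Lemma chain_inN n A (c : chain R X n) : chain_in A c -> chain_in A (- c).
Proof. by move=> Ac s; rewrite domN; exact: Ac. Qed.

Lemma chain_in0 n A : chain_in A (0 : chain R X n).
Proof. by move=> s; rewrite dom0. Qed.

Lemma chain_inU n A k (s : {classic (std_simplex R n -> X)}) :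
  continuous (s : std_simplex R n -> X) -> range s `<=` A ->
  chain_in A << k *g s >>.
Proof.
move=> cs As s'; have [->|k0] := eqVneq k 0; first by rewrite freegU0 dom0.
by rewrite domU// inE => /eqP ->.
Qed.

(** The sum is taken over [dom c], since only the simplices in the support are known to be
    continuous and to lie in [A]. *)
Lemma chain_in_ind n A (P : chain R X n -> Prop) :
  P 0 -> (forall c c', P c -> P c' -> P (c + c')) ->
  (forall k (s : {classic (std_simplex R n -> X)}),
     continuous (s : std_simplex R n -> X) -> range s `<=` A ->
     P << k *g s >>) ->
  forall c, chain_in A c -> P c.
Proof.
move=> P0 PD PU c Ac; rewrite -(freeg_sumE c) big_seq.
by elim/big_ind : _ => // s /Ac[cs As]; exact: PU.
Qed.

Lemma homologous_in_trans n A (c1 c2 c3 : chain R X n) :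
  homologous_in A c1 c2 -> homologous_in A c2 c3 -> homologous_in A c1 c3.
Proof.
move=> [b Ab eb] [b' Ab' eb']; exists (b + b'); first exact: chain_inD.
by rewrite raddfD /= -eb -eb' addrA subrK.
Qed.

Lemma homologous_in_sym n A (c1 c2 : chain R X n) :
  homologous_in A c1 c2 -> homologous_in A c2 c1.
Proof.
move=> [b Ab eb]; exists (- b); first exact: chain_inN.
by rewrite raddfN /= -eb opprB.
Qed.

Lemma within_continuous_compl (S : topologicalType) A (h : X -> Y) (s : S -> X) :
  {within A, continuous h} -> continuous s -> range s `<=` A ->
  continuous (h \o s).
Proof.
move=> /subspace_continuousP ch cs sA t.
have sAt u : A (s u) by apply: sA; exists u.
move=> U /(ch _ (sAt t)) hU; have : nbhs t (s @^-1` [set x | A x -> U (h x)]).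
  exact: cs.
by apply: filterS => u /= /(_ (sAt u)).
Qed.

End Maps.

Lemma continuous_total_comp (S T U : topologicalType) (g : S -> T) (h : T -> U) :
  continuous g -> continuous h -> continuous (fun x => h (g x)).
Proof. by move=> cg ch x; exact: (cvg_for (cg x) (ch (g x))). Qed.

Lemma continuous_pairing (S T U : topologicalType) (g : S -> T) (h : S -> U) :
  continuous g -> continuous h -> continuous (fun x => (g x, h x)).
Proof. by move=> cg ch x; exact: (cvg_pair_nbhs (cg x) (ch x)). Qed.

Lemma continuous_fst (S T : topologicalType) : continuous (@fst S T).
Proof. by move=> [x y]; exact: cvg_fst. Qed.

Lemma continuous_snd (S T : topologicalType) : continuous (@snd S T).
Proof. by move=> [x y]; exact: cvg_snd. Qed.

Lemma continuous_set_type (S X : topologicalType) (A : set X) (g : S -> A) :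
  continuous (fun t => set_val (g t)) -> continuous g.
Proof. exact: (@continuous_comp_initial _ _ _ (@set_val X A) g). Qed.

Definition bary n (t : std_simplex R n) (i : 'I_n.+1) : R := (\val t) 0 i.

Lemma continuous_bary n (i : 'I_n.+1) : continuous (fun t : std_simplex R n => bary t i).
Proof.
move=> t; have cv : set_val u @[u --> t] --> set_val t.
  exact: (@initial_continuous (std_simplex R n) _ set_val t).
exact: (cvg_for cv (@coord_continuous _ _ _ 0 i _)).
Qed.

Lemma cvg_mx (T : Type) (F : set_system T) {FF : Filter F} m n
    (g : T -> 'M[R]_(m, n)) (A : 'M[R]_(m, n)) :
  (forall i j, g x i j @[x --> F] --> A i j) -> g x @[x --> F] --> A.
Proof.
move=> gA U [P PA PU].
have : \forall x \near F, forall i j, P i j (g x i j).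
  by apply: filter_forall => i; apply: filter_forall => j; exact: (gA i j _ (PA i j)).
by apply: filterS => x Px; apply: PU => i j; exact: Px.
Qed.

Lemma continuous_into_simplex (S : topologicalType) n (g : S -> std_simplex R n) :
  (forall i, continuous (fun x => bary (g x) i)) -> continuous g.
Proof.
move=> cg; apply: continuous_set_type => x; apply: cvg_mx => i j.
rewrite set_valE ord1; exact: cg.
Qed.

(* Retraction of the line onto the unit interval. *)
Definition clamp (a : R) : R := (`|a| + 1 - `|a - 1|) / 2.

Lemma clamp_itv a : 0 <= clamp a <= 1.
Proof.
by rewrite /clamp; case: (ger0P a) => ?; case: (ger0P (a - 1)) => ?;
  apply/andP; split; lra.
Qed.

Lemma clamp_id a : 0 <= a <= 1 -> clamp a = a.
Proof.
move=> /andP[a0 a1]; rewrite /clamp ger0_norm// ler0_norm ?subr_le0//; lra.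
Qed.

Lemma continuous_clamp : continuous clamp.
Proof.
move=> a; apply: cvgM; last exact: cvg_cst.
apply: cvgB; first by apply: cvgD; [apply: cvg_norm; exact: cvg_id|exact: cvg_cst].
by apply: cvg_norm; apply: cvgB; [exact: cvg_id|exact: cvg_cst].
Qed.

Definition edge_row (a : R) : 'rV[R]_2 :=
  \row_j (if j == 0 then 1 - clamp a else clamp a).

Lemma edge_point_subproof (a : R) : edge_row a \in std_simplex R 1.
Proof.
have /andP[a0 a1] := clamp_itv a.
apply/mem_set; split=> [i|]; first by rewrite mxE; case: ifP => // _; rewrite subr_ge0.
by rewrite big_ord_recl big_ord1 !mxE /= subrK.
Qed.

(** The inverse of the coordinate [bary _ 1]. Clamping makes it total on the line, so sums of
    coordinates can be fed to it without a proof of their bounds. *)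
Definition edge_point (a : R) : std_simplex R 1 :=
  exist _ (edge_row a) (edge_point_subproof a).

Lemma bary_edge a i :
  bary (edge_point a) i = if i == 0 then 1 - clamp a else clamp a.
Proof. by rewrite /bary mxE. Qed.

Lemma continuous_edge_point : continuous edge_point.
Proof.
apply: continuous_into_simplex => i; under eq_fun do rewrite bary_edge.
move=> a.
case: ifP => _; last exact: continuous_clamp.
by apply: cvgB; [exact: cvg_cst|exact: continuous_clamp].
Qed.

Lemma edge_coord_itv (t : std_simplex R 1) : 0 <= bary t 1 <= 1.
Proof.
have [t0 +] := set_mem (valP t); rewrite big_ord_recl big_ord1.
have -> : fintype.lift ord0 ord0 = 1 :> 'I_2 by exact/val_inj.
by rewrite /bary => t1; have := (t0 ord0, t0 1) => -[? ?]; lra.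
Qed.

Lemma edge_pointK (t : std_simplex R 1) : edge_point (bary t 1) = t.
Proof.
apply/val_inj/rowP => j /=; rewrite mxE clamp_id; last exact: edge_coord_itv.
have [t0] := set_mem (valP t); rewrite big_ord_recl big_ord1.
have -> : fintype.lift ord0 ord0 = 1 :> 'I_2 by exact/val_inj.
move=> t1; have [->|] := eqVneq j 0; first by rewrite -t1 addrK.
by case: j => -[|[|//]] //= i _; congr (_ _ _); exact/val_inj.
Qed.

Lemma bary_face_lift n (i : 'I_n.+2) (t : std_simplex R n) (k : 'I_n.+1) :
  bary (face i t) (fintype.lift i k) = bary t k.
Proof. by rewrite /bary /= mxE liftK. Qed.

Lemma bary_face n (i : 'I_n.+2) (t : std_simplex R n) : bary (face i t) i = 0.
Proof. by rewrite /bary /= mxE unlift_none. Qed.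

Lemma bary1_sum (t : std_simplex R 1) : bary t 0 + bary t 1 = 1.
Proof.
have [t0] := set_mem (valP t); rewrite big_ord_recl big_ord1.
by have -> : fintype.lift ord0 ord0 = 1 :> 'I_2 by exact/val_inj.
Qed.

Lemma bary_ge0 n (t : std_simplex R n) i : 0 <= bary t i.
Proof. by have [t0 _] := set_mem (valP t); exact: t0. Qed.

Lemma bary2_sum (t : std_simplex R 2) : bary t 0 + (bary t 1 + bary t 2) = 1.
Proof.
have [t0] := set_mem (valP t); rewrite !big_ord_recl big_ord0 addr0.
have -> : fintype.lift ord0 ord0 = 1 :> 'I_3 by exact/val_inj.
by have -> : fintype.lift ord0 (fintype.lift ord0 ord0) = 2 :> 'I_3 by exact/val_inj.
Qed.

Lemma vertex_subproof : const_mx 1 \in std_simplex R 0.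
Proof.
apply/mem_set; split=> [i|]; first by rewrite mxE.
by rewrite big_ord1 mxE.
Qed.

Definition vertex : std_simplex R 0 := exist _ (const_mx 1) vertex_subproof.

Lemma bary_vertex : bary vertex 0 = 1.
Proof. by rewrite /bary mxE. Qed.

Let lift10 : fintype.lift ord0 ord0 = 1 :> 'I_2. Proof. exact/val_inj. Qed.

Lemma face0_vertex : face 0 vertex = edge_point 1.
Proof.
rewrite -[LHS]edge_pointK; congr edge_point.
by rewrite -[1 in LHS]lift10 bary_face_lift bary_vertex.
Qed.

Lemma face1_vertex : face 1 vertex = edge_point 0.
Proof. by rewrite -[LHS]edge_pointK; congr edge_point; rewrite bary_face. Qed.

Lemma bary_faces (t : std_simplex R 1) :
  (bary (face 0 t) 0 = 0) * (bary (face 0 t) 1 = bary t 0) *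
  (bary (face 0 t) 2 = bary t 1) * (bary (face 1 t) 0 = bary t 0) *
  (bary (face 1 t) 1 = 0) * (bary (face 1 t) 2 = bary t 1) *
  (bary (face 2 t) 0 = bary t 0) * (bary (face 2 t) 1 = bary t 1) *
  (bary (face 2 t) 2 = 0).
Proof.
have l01 : (1 : 'I_3) = fintype.lift (0 : 'I_3) (0 : 'I_2) by exact/val_inj.
have l02 : (2 : 'I_3) = fintype.lift (0 : 'I_3) (1 : 'I_2) by exact/val_inj.
have l10 : (0 : 'I_3) = fintype.lift (1 : 'I_3) (0 : 'I_2) by exact/val_inj.
have l12 : (2 : 'I_3) = fintype.lift (1 : 'I_3) (1 : 'I_2) by exact/val_inj.
have l20 : (0 : 'I_3) = fintype.lift (2 : 'I_3) (0 : 'I_2) by exact/val_inj.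
have l21 : (1 : 'I_3) = fintype.lift (2 : 'I_3) (1 : 'I_2) by exact/val_inj.
do !split; rewrite ?bary_face//.
- by rewrite l01 bary_face_lift.
- by rewrite l02 bary_face_lift.
- by rewrite [in LHS]l10 bary_face_lift.
- by rewrite l12 bary_face_lift.
- by rewrite [in LHS]l20 bary_face_lift.
- by rewrite l21 bary_face_lift.
Qed.

(** * The prism operator in dimension one *)

Section Prism.
Context {X Y : topologicalType} (G : X * R -> Y).

(** The path of a vertex during the homotopy. These are the sides of the prism; over a cycle they
    cancel. *)
Definition vertex_track (v : {classic (std_simplex R 0 -> X)}) : chain R Y 1 :=
  << (fun t => G (v vertex, bary t 1)) : {classic (std_simplex R 1 -> Y)} >>.

(* The prism over the edge (v0, v1) is cut into the triangles
   (v0,0)(v1,0)(v1,1), the lower one, and (v0,0)(v0,1)(v1,1), the upper one. *)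
Definition prism_lower (s : std_simplex R 1 -> X) : std_simplex R 2 -> Y :=
  fun t => G (s (edge_point (bary t 1 + bary t 2)), bary t 2).

Definition prism_upper (s : std_simplex R 1 -> X) : std_simplex R 2 -> Y :=
  fun t => G (s (edge_point (bary t 2)), bary t 1 + bary t 2).

Definition prism (s : {classic (std_simplex R 1 -> X)}) : chain R Y 2 :=
  << (prism_upper s : {classic _}) >> - << (prism_lower s : {classic _}) >>.

(** Of the six faces, the two diagonals cancel, face 0 of the upper triangle is the top, face 2 of
    the lower one is the bottom, and the remaining two are the tracks of the end points. *)
Lemma boundary_prism (s : {classic (std_simplex R 1 -> X)}) :
  boundary (prism s) =
  << ((fun x => G (x, 1)) \o s : {classic _}) >>
  - << ((fun x => G (x, 0)) \o s : {classic _}) >>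
  - fglift vertex_track (boundary << s >>).
Proof.
have up0 : prism_upper s \o face ord0 = (fun x => G (x, 1)) \o s.
  by apply/funext => t; rewrite /prism_upper /= !bary_faces edge_pointK bary1_sum.
have diag : prism_upper s \o face 1 = prism_lower s \o face 1.
  by apply/funext => t; rewrite /prism_upper /prism_lower /= !bary_faces add0r.
have up2 : prism_upper s \o face 2 = fun t => G ((s \o face 1) vertex, bary t 1).
  by apply/funext => t; rewrite /prism_upper /= !bary_faces addr0 face1_vertex.
have lo0 : prism_lower s \o face ord0 = fun t => G ((s \o face 0) vertex, bary t 1).
  by apply/funext => t; rewrite /prism_lower /= !bary_faces bary1_sum face0_vertex.
have lo2 : prism_lower s \o face 2 = (fun x => G (x, 0)) \o s.
  by apply/funext => t; rewrite /prism_lower /= !bary_faces addr0 edge_pointK.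
have i31 : fintype.lift ord0 ord0 = 1 :> 'I_3 by exact/val_inj.
have i32 : fintype.lift ord0 (fintype.lift ord0 ord0) = 2 :> 'I_3 by exact/val_inj.
have i21 : fintype.lift ord0 ord0 = 1 :> 'I_2 by exact/val_inj.
have s0 n : 1 * (-1) ^+ (ord0 : 'I_n.+1) = 1 :> int by [].
have s1 n : 1 * (-1) ^+ (1%R : 'I_n.+2) = -1 :> int by [].
rewrite /prism raddfB /= !boundaryU !big_ord_recl !big_ord0 i31 i32 i21.
rewrite !s0 !s1 up0 diag up2 lo0 lo2 -[ord0]/(0 : 'I_2) !addr0.
rewrite (raddfD (fglift vertex_track)) /= !liftU scale1r /vertex_track.
rewrite scale_freegU mulr1 -!(freegUN 1).
by apply/eqP/freeg_eqP => y; rewrite !(coeffD, coeffN); ring.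
Qed.

Lemma boundary_prism_chain (c : chain R X 1) :
  boundary (fglift prism c) =
  pushforward (fun x => G (x, 1)) c - pushforward (fun x => G (x, 0)) c
  - fglift vertex_track (boundary c).
Proof.
elim/freeg_ind_dom0: c => [|k s c _ _ IHc]; first by rewrite !(raddf0, subr0).
rewrite !raddfD /= IHc.
have -> : << k *g s >> = << s >> *~ k by rewrite freeg_mulz intz.
rewrite !raddfMz /= liftU scale1r boundary_prism !pushforwardU.
rewrite !mulrzBl; apply/eqP/freeg_eqP => y; rewrite !(coeffD, coeffN); ring.
Qed.

Lemma homotopy_homologous (A : set X) (B : set Y) (c : chain R X 1) :
  {within A `*` `[0, 1], continuous G} ->
  (forall x s, A x -> 0 <= s <= 1 -> B (G (x, s))) ->
  cycle_in A c ->
  homologous_in B (pushforward (fun x => G (x, 1)) c)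
                  (pushforward (fun x => G (x, 0)) c).
Proof.
move=> cG GB [Ac c0]; exists (fglift prism c); last first.
  by rewrite boundary_prism_chain c0 raddf0 subr0.
move: c Ac {c0}; apply: chain_in_ind => [|c c' Bc Bc'|k s cs As].
- by rewrite raddf0; exact: chain_in0.
- by rewrite raddfD; exact: chain_inD.
rewrite liftU scalerBr !scale_freegU.
have sum01 (t : std_simplex R 2) : 0 <= bary t 1 + bary t 2 <= 1.
  have := bary2_sum t; have := (bary_ge0 t 0, bary_ge0 t 1, bary_ge0 t 2).
  by move=> [[? ?] ?] ?; apply/andP; split; lra.
have b01 (t : std_simplex R 2) : 0 <= bary t 2 <= 1.
  have := bary2_sum t; have := (bary_ge0 t 0, bary_ge0 t 1, bary_ge0 t 2).
  by move=> [[? ?] ?] ?; apply/andP; split; lra.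
have c1 : continuous (fun t : std_simplex R 2 => bary t 1) by exact: continuous_bary.
have c2 : continuous (fun t : std_simplex R 2 => bary t 2) by exact: continuous_bary.
have c12 : continuous (fun t : std_simplex R 2 => bary t 1 + bary t 2).
  by move=> t; exact: (cvgD (c1 t) (c2 t)).
have sAt u : A (s u) by apply: As; exists u.
(* Both triangles have this shape, with [p] the position on the edge and [r] the time. *)
have key (p r : std_simplex R 2 -> R) : continuous p -> continuous r ->
    (forall t, 0 <= r t <= 1) ->
    continuous (fun t => G (s (edge_point (p t)), r t)) /\
    range (fun t => G (s (edge_point (p t)), r t)) `<=` B.
  move=> cp cr r01; split; last by move=> _ [t _ <-]; exact: GB.
  apply: (within_continuous_compl cG (s := fun t => (s (edge_point (p t)), r t))).
    apply: continuous_pairing => //; apply: (continuous_total_comp _ cs).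
    exact: (continuous_total_comp cp continuous_edge_point).
  by move=> _ [t _ <-]; split => //=; rewrite in_itv/=.
have [cu Bu] := key _ _ c2 c12 sum01; have [cl Bl] := key _ _ c12 c2 b01.
by apply: chain_inD; [|apply: chain_inN]; exact: chain_inU.
Qed.

End Prism.

End Chains.

(** * Winding numbers of singular 1-chains *)

Section Winding.
Context {R : realType}.

Lemma bary_inj n (t t' : std_simplex R n) : bary t =1 bary t' -> t = t'.
Proof. by move=> tt'; apply/val_inj/rowP => i; exact: tt'. Qed.

Lemma continuous_face n (i : 'I_n.+2) : continuous (@face R n i).
Proof.
apply: continuous_into_simplex => j; case: (unliftP i j) => [k ->|->].
  by under eq_fun do rewrite bary_face_lift; exact: continuous_bary.
by under eq_fun do rewrite bary_face; exact: cst_continuous.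
Qed.

(** The straight-line contraction to vertex 0, whose barycentric coordinates are [(j == 0)%:R]: time
    0 gives that vertex, time 1 the identity. *)
Definition cone_row n (r : R) (t : std_simplex R n) : 'rV[R]_n.+1 :=
  \row_j ((1 - clamp r) * (j == 0)%:R + clamp r * bary t j).

Lemma cone_subproof n (r : R) (t : std_simplex R n) :
  cone_row r t \in std_simplex R n.
Proof.
have /andP[r0 r1] := clamp_itv r; have [t0 t1] := set_mem (valP t).
apply/mem_set; split=> [i|].
  by rewrite mxE addr_ge0// mulr_ge0// ?subr_ge0//; exact: t0.
under eq_bigr do rewrite mxE.
rewrite big_split /= -!mulr_sumr t1 mulr1 (bigD1 0)//= big1 => [|i /negbTE ->//].
by rewrite addr0 mulr1 subrK.
Qed.

Definition cone n (r : R) (t : std_simplex R n) : std_simplex R n :=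
  exist _ (cone_row r t) (cone_subproof r t).

Lemma bary_cone n r (t : std_simplex R n) i :
  bary (cone r t) i = (1 - clamp r) * (i == 0)%:R + clamp r * bary t i.
Proof. by rewrite {1}/bary mxE. Qed.

Lemma cone0 n (t t' : std_simplex R n) : cone 0 t = cone 0 t'.
Proof.
by apply: bary_inj => i; rewrite !bary_cone clamp_id ?lexx ?ler01// !mul0r.
Qed.

Lemma cone1 n (t : std_simplex R n) : cone 1 t = t.
Proof.
apply: bary_inj => i; rewrite bary_cone clamp_id ?lexx ?ler01//.
by rewrite subrr mul0r add0r mul1r.
Qed.

Lemma continuous_cone n :
  continuous (fun x : std_simplex R n * R => cone x.2 x.1).
Proof.
have c1 : continuous (fun x : std_simplex R n * R => clamp x.2).
  apply: (continuous_total_comp _ continuous_clamp).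
  by move=> [x y]; exact: cvg_snd.
have c2 i : continuous (fun x : std_simplex R n * R => bary x.1 i).
  apply: (continuous_total_comp _ (@continuous_bary R n i)).
  by move=> [x y]; exact: cvg_fst.
apply: continuous_into_simplex => j; under eq_fun do rewrite bary_cone.
move=> x.
apply: cvgD; apply: cvgM; [|exact: cvg_cst|exact: c1|exact: c2].
by apply: cvgB; [exact: cvg_cst|exact: c1].
Qed.

Context {X : topologicalType} (A : set X) (a : X -> R * R).
Hypothesis conta : {within A, continuous a}.
Hypothesis circa : forall x, A x -> circle (a x).

Lemma simplex_lift n (s : std_simplex R n -> X) :
  continuous s -> range s `<=` A ->
  exists2 t : std_simplex R n -> R, continuous t &
    forall x, cexp (t x) = a (s x).
Proof.
move=> cs As; have sA u : A (s u) by apply: As; exists u.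
(* A point is wanted only to name the apex as [cone 0 z]; the case split spares its construction. *)
case: (pselect (exists z : std_simplex R n, True)) => [[z _]|noz]; last first.
  by exists (fun=> 0) => [z|z]; case: noz; exists z.
have [t0 t0E] := cexp_surj (circa (sA (cone 0 z))).
pose G (x : std_simplex R n * R) := a (s (cone x.2 x.1)).
have cG : continuous G.
  apply: (within_continuous_compl conta (s := fun x => s (cone x.2 x.1))).
    exact: (continuous_total_comp (@continuous_cone n) cs).
  by move=> _ [x _ <-].
have [|||t ct tE] := @homotopy_lift R _ [set: std_simplex R n] G t0 openT.
- by move=> x r _ _; exact: cG.
- by move=> x r _ _; exact: circa.
- by move=> x _; rewrite /G /= t0E (cone0 x z).
exists t => x; first exact: ct.
by rewrite tE// /G /= cone1.
Qed.

(* [zmodule R] is [R] as a module over [int]. The winding is the junk value [0]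
   when [a \o s] has no lift. *)
Definition winding (s : {classic (std_simplex R 1 -> X)}) : zmodule R :=
  xget 0 [set v : R | exists t : std_simplex R 1 -> R, [/\ continuous t,
    forall x, cexp (t x) = a (s x) & v = t (edge_point 1) - t (edge_point 0)]].

(** Any lift computes the winding, because two lifts differ by a constant integer. *)
Lemma windingE (s : std_simplex R 1 -> X) (t : std_simplex R 1 -> R) :
  continuous t -> (forall x, cexp (t x) = a (s x)) ->
  winding s = t (edge_point 1) - t (edge_point 0).
Proof.
move=> ct tE; apply: xget_unique; first by exists t.
move=> _ [t' [ct' t'E ->]].
suff : t' (edge_point 0) - t (edge_point 0) = t' (edge_point 1) - t (edge_point 1).
  by move=> ?; lra.
apply: (@int_valued_constant R (fun r => t' (edge_point r) - t (edge_point r))).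
  apply: continuous_subspaceT => r; apply: cvgB.
    exact: (continuous_total_comp continuous_edge_point ct').
  exact: (continuous_total_comp continuous_edge_point ct).
move=> r _; have [|n ->] := @cexp_inj R (t' (edge_point r)) (t (edge_point r)).
  by rewrite t'E tE.
by exists n; rewrite addrAC subrr add0r.
Qed.

Lemma edge_point0_bary : (bary (edge_point (0 : R)) 0 = 1) * (bary (edge_point (0 : R)) 1 = 0).
Proof. by rewrite !bary_edge /= clamp_id ?lexx ?ler01// subr0. Qed.

Lemma edge_point1_bary : (bary (edge_point (1 : R)) 0 = 0) * (bary (edge_point (1 : R)) 1 = 1).
Proof. by rewrite !bary_edge /= clamp_id ?lexx ?ler01// subrr. Qed.

Lemma ord3P (P : 'I_3 -> Prop) : P 0 -> P 1 -> P 2 -> forall i, P i.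
Proof.
move=> P0 P1 P2 [[|[|[|//]]] i].
- by rewrite (_ : Ordinal i = 0)//; exact/val_inj.
- by rewrite (_ : Ordinal i = 1)//; exact/val_inj.
- by rewrite (_ : Ordinal i = 2)//; exact/val_inj.
Qed.

Definition winding_chain : chain R X 1 -> zmodule R := fglift winding.

(** A single lift over the triangle restricts to lifts over its three edges, so the windings
    telescope around the vertices. *)
Lemma winding_boundary (b : chain R X 2) :
  chain_in A b -> winding_chain (boundary b) = 0.
Proof.
move: b; apply: chain_in_ind => [|c c' c0 c'0|k s cs As].
- by rewrite /winding_chain !raddf0.
- move: c0 c'0; rewrite /winding_chain !raddfD /= => -> ->; exact: addr0.
rewrite /winding_chain boundaryU raddf_sum /=.
have [t ct tE] := simplex_lift cs As.
have wE (i : 'I_3) : winding (s \o face i) =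
    t (face i (edge_point 1)) - t (face i (edge_point 0)).
  apply: (@windingE _ (t \o face i)) => [|x]; last exact: tE.
  exact: (continuous_total_comp (@continuous_face 1 i) ct).
under eq_bigr do rewrite liftU.
rewrite !big_ord_recl big_ord0.
have -> : fintype.lift ord0 ord0 = 1 :> 'I_3 by exact/val_inj.
have -> : fintype.lift ord0 (fintype.lift ord0 ord0) = 2 :> 'I_3 by exact/val_inj.
rewrite !(wE ord0, wE 1, wE 2).
(* Each vertex of the triangle is an end of two edges; identifying them leaves three values of
   [t]. *)
have bE := (edge_point0_bary, edge_point1_bary, bary_faces).
have -> : face 1 (edge_point 1) = face 0 (edge_point 1) :> std_simplex R 2.
  by apply: bary_inj; apply: ord3P; rewrite !bE.
have -> : face 2 (edge_point 1) = face 0 (edge_point 0) :> std_simplex R 2.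
  by apply: bary_inj; apply: ord3P; rewrite !bE.
have -> : face 2 (edge_point 0) = face 1 (edge_point 0) :> std_simplex R 2.
  by apply: bary_inj; apply: ord3P; rewrite !bE.
have s0 : k * (-1) ^+ (ord0 : 'I_3) = k by rewrite expr0 mulr1.
have s1 : k * (-1) ^+ (1%R : 'I_3) = - k by rewrite expr1 mulrN1.
rewrite s0 s1 -[ord0]/(0 : 'I_3) scaleNr -scalerN addr0 -!scalerDr.
rewrite [X in _ *: X](_ : _ = 0) ?scaler0// -[RHS]/(0 : R).
by move: (t _) (t _) (t _) => u v w; rewrite -[LHS]/(w - v + (- (w - u) + (v - u)) : R); ring.
Qed.

End Winding.

(** * The universal cover of the basin and the linearization *)

Section GeometricLimit.
Context {R : realType}.
Variables (u : nat -> R) (C : R) (N : nat).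
Hypothesis uC : forall n, (N <= n)%N -> `|u n.+1 - u n| <= C / 2 ^+ n.+1.

Lemma geometric_step_dist n k : (N <= n)%N ->
  `|u (n + k)%N - u n| <= C / 2 ^+ n - C / 2 ^+ (n + k).
Proof.
move=> Nn; elim: k => [|k IHk]; first by rewrite addn0 !subrr normr0.
(* The bound telescopes because C/2^m - C/2^(m+1) = C/2^(m+1). *)
have e : C / 2 ^+ (n + k) = C / 2 ^+ (n + k).+1 + C / 2 ^+ (n + k).+1.
  by rewrite exprS; field; rewrite expf_neq0.
have := uC (leq_trans Nn (leq_addr k n)); rewrite addnS => h.
apply: le_trans (ler_distD (u (n + k)%N) _ _) _.
apply: (le_trans (lerD h IHk)); rewrite e; lra.
Qed.

Let C0 : 0 <= C.
Proof.
have := le_trans (normr_ge0 _) (uC (leqnn N)).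
by rewrite pmulr_lge0// invr_gt0 exprn_gt0.
Qed.

Let geom_ge0 n : 0 <= C / 2 ^+ n.
Proof. by rewrite divr_ge0// exprn_ge0. Qed.

Lemma geometric_step_cvg : cvgn u.
Proof.
apply/cvg_ex; suff [l hl] : exists l : R, (fun n => u (n + N)%N) @ \oo --> l.
  by exists l; rewrite -(cvg_shiftn N).
(* Subtracting the tail bound makes the sequence nondecreasing, so monotone convergence applies. *)
pose v n := u (n + N)%N - C / 2 ^+ (n + N).
have cv : cvgn v.
  apply: nondecreasing_is_cvgn.
    apply/nondecreasing_seqP => n; rewrite /v addSn.
    have := @geometric_step_dist (n + N)%N 1 (leq_addl _ _).
    by rewrite addn1 ler_distl => /andP[h _]; lra.
  exists (u N + C / 2 ^+ N) => _ [n _ <-].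
  have := @geometric_step_dist N n (leqnn N); rewrite addnC ler_distl => /andP[_ h].
  by have := geom_ge0 (n + N); rewrite /v; lra.
exists (limn v + 0).
have -> : (fun n => u (n + N)%N) = (fun n => v n + C / 2 ^+ (n + N)).
  by apply/funext => n; rewrite /v subrK.
apply: cvgD => //.
have : (fun m : nat => C / 2 ^+ m) @ \oo --> (0 : R).
  under eq_fun do rewrite -exprVn.
  by apply: cvg_geometric; rewrite ger0_norm; lra.
by rewrite -(cvg_shiftn N).
Qed.

Lemma geometric_step_lim n : (N <= n)%N -> `|limn u - u n| <= C / 2 ^+ n.
Proof.
move=> Nn; rewrite ler_distl; apply/andP; split.
  apply: limr_ge; first exact: geometric_step_cvg.
  near=> m; have nm : (n <= m)%N by near: m; exact: nbhs_infty_ge.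
  have := @geometric_step_dist n (m - n) Nn; rewrite subnKC// ler_distl => /andP[h _].
  by have := geom_ge0 m; lra.
apply: limr_le; first exact: geometric_step_cvg.
near=> m; have nm : (n <= m)%N by near: m; exact: nbhs_infty_ge.
have := @geometric_step_dist n (m - n) Nn; rewrite subnKC// ler_distl => /andP[_ h].
by have := geom_ge0 m; lra.
Unshelve. all: by end_near. Qed.

End GeometricLimit.

(** An argument with thirds of [e]: [C] and [N] serve all points near [x], so the tails are
    uniformly small there. The terms of index below [N] need no bound. *)
Lemma geometric_step_continuous {R : realType} (T : topologicalType)
    (u : nat -> T -> R) (C : R) (N : nat) (x : T) :
  (forall n, {for x, continuous (u n)}) ->
  (\forall y \near x, forall n, (N <= n)%N ->
     `|u n.+1 y - u n y| <= C / 2 ^+ n.+1) ->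
  {for x, continuous (fun y => limn (u ^~ y))}.
Proof.
move=> cu uC; apply/cvgrPdist_le => /= e e0.
have [n Nn Cn] : exists2 n, (N <= n)%N & C / 2 ^+ n <= e / 3.
  have : C / 2 ^+ m @[m --> \oo] --> (0 : R).
    under eq_fun do rewrite -exprVn.
    by apply: cvg_geometric; rewrite ger0_norm; lra.
  move=> /cvgrPdist_le /(_ (e / 3)) []; first by lra.
  move=> n0 _ h; exists (maxn N n0); first exact: leq_maxl.
  have := h (maxn N n0) (leq_maxr _ _); rewrite sub0r normrN; exact/le_trans/ler_norm.
have ux := geometric_step_lim (nbhs_singleton uC) Nn.
have e3 : 0 < e / 3 by lra.
have := cu n => /cvgrPdist_le /(_ _ e3) un.
near=> y; have uy : `|limn (u ^~ y) - u n y| <= C / 2 ^+ n.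
  by apply: (geometric_step_lim _ Nn); near: y.
have uxy : `|u n x - u n y| <= e / 3 by near: y.
move: ux uy uxy; rewrite !ler_distl => /andP[? ?] /andP[? ?] /andP[? ?].
by apply/andP; split; lra.
Unshelve. all: by end_near. Qed.

(** * The strip as universal cover of the annulus *)

Section Annulus.
Context {R : realType} {M : topologicalType} (B : set M).
Variables (p : R * (R * R) -> M) (q : M -> R * (R * R)).
Hypothesis contp : {within annulus, continuous p}.
Hypothesis imp : p @` annulus = B.
Hypothesis contq : {within B, continuous q}.
Hypothesis pK : forall x, annulus x -> q (p x) = x.

Definition strip : set (R * R) := [set z | 0 < z.1 < 1].

Lemma open_strip : open strip.
Proof.
have -> : strip = fst @^-1` (`]0, 1[ : set R).
  by apply/seteqP; split => z; rewrite /strip /= in_itv.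
apply: open_comp; last exact: interval_open.
by move=> [x y] _; exact: cvg_fst.
Qed.

Lemma strip_annulus z : strip z -> annulus (z.1, cexp z.2).
Proof. by move=> z01; split; [rewrite /= in_itv|exact: cexp_circle]. Qed.

Lemma cover_in z : strip z -> B (annulus_cover p z).
Proof. by move=> /strip_annulus ?; rewrite -imp; exists (z.1, cexp z.2). Qed.

Lemma cover_q z : strip z -> q (annulus_cover p z) = (z.1, cexp z.2).
Proof. by move=> /strip_annulus; exact: pK. Qed.

Lemma q_annulus x : B x -> annulus (q x).
Proof. by rewrite -imp => -[y Ay <-]; rewrite pK. Qed.

Lemma qK x : B x -> p (q x) = x.
Proof. by rewrite -imp => -[y Ay <-]; rewrite pK. Qed.

Lemma cover_surj x : B x -> exists2 z, strip z & annulus_cover p z = x.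
Proof.
move=> Bx; have [q1 q2] := q_annulus Bx; have [y yE] := cexp_surj q2.
exists ((q x).1, y); first by move: q1; rewrite /= in_itv.
by rewrite /annulus_cover /= yE -surjective_pairing qK.
Qed.

Lemma continuous_cover z : strip z -> {for z, continuous (annulus_cover p)}.
Proof.
move=> sz U.
have /subspace_continuousP cp := contp.
move=> /(cp _ (strip_annulus sz)) hU.
have c : {for z, continuous (fun w : R * R => (w.1, cexp w.2) : R * (R * R))}.
  apply: (continuous_pairing (@continuous_fst _ _)).
  exact: (continuous_total_comp (@continuous_snd _ _) (@continuous_cexp R)).
have nU : nbhs z [set w | annulus (w.1, cexp w.2) -> U (annulus_cover p w)].
  exact: c hU.
have oS : nbhs z strip by apply: open_nbhs_nbhs; split => //; exact: open_strip.
suff : nbhs z [set w | U (annulus_cover p w)] by [].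
by apply: filterS2 nU oS => w /= hw sw; exact: hw (strip_annulus sw).
Qed.

Definition angle x := (q x).2.

Lemma continuous_angle : {within B, continuous angle}.
Proof.
apply/subspace_continuousP => x Bx.
have /subspace_continuousP/(_ x Bx) cq := contq; exact: (cvg_proj2 cq).
Qed.

Lemma angle_circle x : B x -> circle (angle x).
Proof. by move=> /q_annulus[]. Qed.

Let segment_strip (z : R * R) (s : R) : strip z -> 0 <= s <= 1 ->
  strip ((1 - s) / 2 + s * z.1, s * z.2).
Proof.
case: z => x y; rewrite /strip /= => /andP[x0 x1] /andP[s0 s1].
by apply/andP; split; nra.
Qed.

Let continuous_segment : continuous (fun w : (R * R) * R =>
  ((1 - w.2) / 2 + w.2 * w.1.1, w.2 * w.1.2)).
Proof.
have c2 : continuous (fun w : (R * R) * R => w.2) by exact: continuous_snd.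
have c11 : continuous (fun w : (R * R) * R => w.1.1).
  exact: (continuous_total_comp (@continuous_fst _ _) (@continuous_fst _ _)).
have c12 : continuous (fun w : (R * R) * R => w.1.2).
  exact: (continuous_total_comp (@continuous_fst _ _) (@continuous_snd _ _)).
apply: continuous_pairing => w; last exact: cvgM (c2 w) (c12 w).
apply: cvgD; last exact: cvgM (c2 w) (c11 w).
by apply: cvgM; last exact: cvg_cst; apply: cvgB; [exact: cvg_cst|exact: c2].
Qed.

(** The strip is convex: following [g] along the segment from (1/2, 0) to [z] is a homotopy that
    starts at a constant. *)
Lemma strip_lift (g : R * R -> R * R) :
  (forall z, strip z -> {for z, continuous g}) ->
  (forall z, strip z -> circle (g z)) ->
  exists2 t : R * R -> R, forall z, strip z -> {for z, continuous t} &
    forall z, strip z -> cexp (t z) = g z.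
Proof.
move=> cg gc; have s0 : strip (1 / 2, 0) by rewrite /strip /=; apply/andP; split; lra.
have [t0 t0E] := cexp_surj (gc _ s0).
pose G (w : (R * R) * R) := g ((1 - w.2) / 2 + w.2 * w.1.1, w.2 * w.1.2).
have [|||t ct tE] := @homotopy_lift R _ strip G t0 open_strip.
- move=> z s sz s01.
  exact: (cvg_for (@continuous_segment (z, s)) (cg _ (segment_strip sz s01))).
- by move=> z s sz s01; exact/gc/segment_strip.
- by move=> z sz; rewrite /G /= t0E; congr g; congr (_, _); ring.
exists t => // z sz; rewrite tE// /G /=; congr g; case: z {sz} => x y /=.
by congr (_, _); ring.
Qed.

Lemma strip_int_constant (t : R * R -> R) :
  (forall z, strip z -> {for z, continuous t}) ->
  (forall z, strip z -> exists n : int, t z = n%:~R) ->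
  forall z, strip z -> t z = t (1 / 2, 0).
Proof.
move=> ct ti z sz.
have -> : t z = t ((1 - 1) / 2 + 1 * z.1, 1 * z.2).
  by congr t; case: z {sz} => x y /=; congr (_, _); ring.
have -> : (1 / 2, 0) = ((1 - 0) / 2 + 0 * z.1, 0 * z.2) :> R * R.
  by congr (_, _); ring.
apply/esym.
apply: (@int_valued_constant R (fun s => t ((1 - s) / 2 + s * z.1, s * z.2))).
  apply/subspace_continuousP => s; rewrite /= in_itv/= => s01.
  have cs : (z, r) @[r --> within `[0, 1] (nbhs s)] --> (z, s).
    by apply: cvg_pair_nbhs; [exact: cvg_cst|exact: cvg_within].
  exact: (cvg_for (cvg_for cs (@continuous_segment _)) (ct _ (segment_strip sz s01))).
by move=> s s01; exact/ti/segment_strip.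
Qed.

End Annulus.

Lemma within_continuous_for (S T U : topologicalType) (B : set T) (a : T -> U)
    (g : S -> T) (z : S) :
  {within B, continuous a} -> {for z, continuous g} -> B (g z) ->
  (\forall w \near z, B (g w)) -> {for z, continuous (fun w => a (g w))}.
Proof.
move=> /subspace_continuousP ca cg Bz nB V /(ca _ Bz) hV.
have nV : nbhs z [set w | B (g w) -> V (a (g w))] by exact: cg hV.
suff : nbhs z [set w | V (a (g w))] by [].
by apply: filterS2 nV nB => w /= h /h.
Qed.

(** * The degree as the translation number of the lift *)

Section Degree.
Context {R : realType} {M : topologicalType} (B : set M).
Variables (p : R * (R * R) -> M) (q : M -> R * (R * R)).
Hypothesis contp : {within annulus, continuous p}.
Hypothesis imp : p @` annulus = B.
Hypothesis contq : {within B, continuous q}.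
Hypothesis pK : forall x, annulus x -> q (p x) = x.
Variables (f : M -> M) (d : nat).
Hypothesis contf : continuous f.
Hypothesis fB : forall x, B x -> B (f x).
Hypothesis degf : H1_multiplication R B f d.

Local Notation pi := (annulus_cover p).
Local Notation ang := (angle q).

Let near_strip (z : R * R) : strip z -> \forall w \near z, strip w.
Proof. by move=> sz; apply: open_nbhs_nbhs; split => //; exact: open_strip. Qed.

Let near_cover z : strip z -> \forall w \near z, B (f (pi w)).
Proof.
by move=> /near_strip; apply: filterS => w sw; apply/fB/(cover_in imp).
Qed.

Let continuous_fcover z : strip z -> {for z, continuous (fun w => f (pi w))}.
Proof. by move=> sz; exact: (cvg_for (continuous_cover contp sz) (@contf _)). Qed.

Let shift_continuous (z : R * R) : {for z, continuous (fun w : R * R => (w.1, w.2 + 1))}.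
Proof.
apply: (continuous_pairing (@continuous_fst _ _)) => w.
by apply: cvgD; [exact: continuous_snd|exact: cvg_cst].
Qed.

Lemma exists_lift : exists2 t : R * R -> R,
  forall z, strip z -> {for z, continuous t} &
  forall z, strip z -> cexp (t z) = ang (f (pi z)).
Proof.
apply: strip_lift => z sz; last first.
  by apply: (angle_circle imp pK); apply/fB/(cover_in imp).
apply: (within_continuous_for (continuous_angle contq)).
- exact: continuous_fcover.
- exact/fB/(cover_in imp).
- exact: near_cover.
Qed.

Variable t : R * R -> R.
Hypothesis contt : forall z, strip z -> {for z, continuous t}.
Hypothesis tE : forall z, strip z -> cexp (t z) = ang (f (pi z)).

Lemma lift_shift_int : exists k : int,
  forall z, strip z -> t (z.1, z.2 + 1) = t z + k%:~R.
Proof.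
have ti z : strip z -> exists n : int, t (z.1, z.2 + 1) - t z = n%:~R.
  move=> sz; have [|n ->] := @cexp_inj R (t (z.1, z.2 + 1)) (t z).
    by rewrite !tE// /annulus_cover /= cexp1.
  by exists n; rewrite addrAC subrr add0r.
have s0 : strip (1 / 2, 0 : R) by rewrite /strip /=; apply/andP; split; lra.
have [k k0] := ti _ s0; exists k => z sz.
have ct (w : R * R) : strip w ->
    {for w, continuous (fun v : R * R => t (v.1, v.2 + 1) - t v)}.
  move=> sw; apply: cvgB; last exact: contt.
  exact: (cvg_for (@shift_continuous w) (contt _)).
have := strip_int_constant ct ti sz; rewrite k0 => <-; ring.
Qed.

(** The core circle of the annulus as one singular simplex; it represents a generator of the first
    homology group. *)
Let loop : std_simplex R 1 -> M := fun x => pi (1 / 2, bary x 1).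

Let loop_strip (r : R) : strip (1 / 2 : R, r).
Proof. by rewrite /strip /=; apply/andP; split; lra. Qed.

Let continuous_loop_param : continuous (fun x : std_simplex R 1 => (1 / 2 : R, bary x 1)).
Proof. by apply: continuous_pairing; [exact: cst_continuous|exact: continuous_bary]. Qed.

Lemma lift_degree z : strip z -> t (z.1, z.2 + 1) = t z + d%:R.
Proof.
have [k kE] := lift_shift_int; rewrite -[d%:R]/((d : int)%:~R).
suff -> : (d : int) = k by exact: kE.
have loopc : continuous loop.
  by move=> x; exact: (cvg_for (@continuous_loop_param x) (continuous_cover contp (loop_strip _))).
have loopB : range loop `<=` B by move=> _ [x _ <-]; exact/(cover_in imp)/loop_strip.
pose c : chain R M 1 := << (loop : {classic (std_simplex R 1 -> M)}) >>.
have c0 : boundary c = 0.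
  rewrite boundaryU !big_ord_recl big_ord0 addr0.
  have -> : fintype.lift ord0 ord0 = 1 :> 'I_2 by exact/val_inj.
  have -> : loop \o face 1 = loop \o face ord0.
    apply/funext => x; rewrite /loop /= bary_face /annulus_cover /=.
    have -> : bary (face ord0 x) 1 = 1.
      have l : (1 : 'I_2) = fintype.lift ord0 ord0 by exact/val_inj.
      rewrite {1}l bary_face_lift.
      by have [_] := set_mem (valP x); rewrite big_ord1.
    by have := cexp1 (0 : R); rewrite add0r => ->.
  by rewrite freegUD expr0 expr1 !mul1r subrr freegU0.
have Bc : cycle_in B c by split => //; exact: chain_inU.
have [b Bb bE] := degf Bc.
(* [f] of the loop minus [d] times the loop is a boundary, so its winding is 0. *)
have := winding_boundary (continuous_angle contq) (angle_circle imp pK) Bb.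
rewrite -bE /winding_chain raddfB raddfMn /= pushforwardU !liftU !scale1r.
rewrite (@windingE _ _ _ (f \o loop) (fun x => t (1 / 2, bary x 1))); last 2 first.
- by move=> x; exact: (cvg_for (@continuous_loop_param x) (contt (loop_strip _))).
- by move=> x; rewrite tE.
rewrite (@windingE _ _ _ loop (fun x => bary x 1)); last 2 first.
- exact: continuous_bary.
- by move=> x; rewrite /angle (cover_q pK)//; exact: loop_strip.
rewrite !edge_point0_bary !edge_point1_bary.
(* Along the image of the loop the lift [t] grows by [k] between the ends; along the loop itself the
   angle grows by 1. *)
have := kE (1 / 2, 0) (loop_strip 0); rewrite /= add0r => ->.
(* The equation holds in [zmodule R]; it is restated in [R], where [lra] applies. *)
move=> h; have {}h : t (1 / 2, 0) + k%:~R - t (1 / 2, 0) - (1 - 0) *+ d = 0 :> R := h.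
move: h; rewrite subr0 => h.
by apply/eqP; rewrite -(eqr_int R); apply/eqP; rewrite -[(d : int)%:~R]/(d%:R); lra.
Qed.

End Degree.

(** * The linearizing function on the strip *)

Section Linearization.
Context {R : realType} {M : topologicalType} (B : set M).
Variables (p : R * (R * R) -> M) (q : M -> R * (R * R)).
Hypothesis contp : {within annulus, continuous p}.
Hypothesis imp : p @` annulus = B.
Hypothesis contq : {within B, continuous q}.
Hypothesis pK : forall x, annulus x -> q (p x) = x.
Variables (f : M -> M) (d : nat).
Hypothesis contf : continuous f.
Hypothesis fB : forall x, B x -> B (f x).
Hypothesis d_gt1 : (1 < d)%N.

Local Notation pi := (annulus_cover p).

Variable t : R * R -> R.
Hypothesis contt : forall z, strip z -> {for z, continuous t}.
Hypothesis tE : forall z, strip z -> cexp (t z) = angle q (f (pi z)).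
Hypothesis tS : forall z, strip z -> t (z.1, z.2 + 1) = t z + d%:R.

Definition cover_lift (z : R * R) : R * R := ((q (f (pi z))).1, t z).

Local Notation F := cover_lift.

Lemma strip_lift_closed z : strip z -> strip (F z).
Proof.
move=> sz; have [+ _] := q_annulus imp pK (fB (cover_in imp sz)).
by rewrite /= in_itv.
Qed.

Lemma cover_lift_semiconj z : strip z -> pi (F z) = f (pi z).
Proof.
move=> sz; rewrite /annulus_cover /= tE// /angle -surjective_pairing.
exact/(qK imp pK)/fB/(cover_in imp).
Qed.

Lemma continuous_cover_lift z : strip z -> {for z, continuous F}.
Proof.
move=> sz; apply: cvg_pair_nbhs; last exact: contt.
have cq : {for z, continuous (fun w => q (f (pi w)))}.
  apply: (within_continuous_for contq).
  - exact: (cvg_for (continuous_cover contp sz) (@contf _)).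
  - exact/fB/(cover_in imp).
  - have : \forall w \near z, strip w.
      by apply: open_nbhs_nbhs; split => //; exact: open_strip.
    by apply: filterS => w sw; apply/fB/(cover_in imp).
exact: cvg_proj1 cq.
Qed.

Lemma iter_strip n z : strip z -> strip (iter n F z).
Proof. by move=> sz; elim: n => //= n; exact: strip_lift_closed. Qed.

Lemma iter_cover n z : strip z -> pi (iter n F z) = iter n f (pi z).
Proof.
by move=> sz; elim: n => //= n <-; apply/cover_lift_semiconj/iter_strip.
Qed.

Lemma continuous_iter_lift n z : strip z -> {for z, continuous (iter n F)}.
Proof.
move=> sz; elim: n => [|n IHn]; first exact: cvg_id.
exact: (cvg_for IHn (continuous_cover_lift (iter_strip n sz))).
Qed.

Let shift_strip (z : R * R) r : strip z -> strip (z.1, r).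
Proof. by []. Qed.

Lemma lift_shift_nat z m : strip z -> t (z.1, z.2 + m%:R) = t z + (d * m)%:R.
Proof.
move=> sz; elim: m => [|m IHm].
  by rewrite addr0 muln0 addr0 -surjective_pairing.
rewrite -natr1 addrA (tS (shift_strip _ sz)) IHm mulnS natrD -addrA.
by rewrite [_%:R + d%:R]addrC.
Qed.

Lemma cover_lift_shift z m : strip z ->
  F (z.1, z.2 + m%:R) = ((F z).1, (F z).2 + (d * m)%:R).
Proof.
by move=> sz; rewrite /cover_lift lift_shift_nat// /annulus_cover /= cexp_nat.
Qed.

Lemma iter_lift_shift n z : strip z ->
  iter n F (z.1, z.2 + 1) = ((iter n F z).1, (iter n F z).2 + (d ^ n)%:R).
Proof.
by move=> sz; elim: n => //= n ->; rewrite cover_lift_shift ?expnS//; exact: iter_strip.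
Qed.

Definition displacement (z : R * R) : R := t z - d%:R * z.2.

Lemma displacement_int z (m : int) : strip z ->
  displacement (z.1, z.2 + m%:~R) = displacement z.
Proof.
have dn w n : strip w -> displacement (w.1, w.2 + n%:R) = displacement w.
  by move=> sw; rewrite /displacement lift_shift_nat// natrM /=; ring.
case: m => m sz; first exact: dn.
have := dn (z.1, z.2 + (Negz m)%:~R) m.+1 (shift_strip _ sz).
by rewrite /= NegzE mulrNz subrK -surjective_pairing.
Qed.

Lemma continuous_displacement z : strip z -> {for z, continuous displacement}.
Proof.
move=> sz; apply: cvgB; first exact: contt.
by apply: cvgM; [exact: cvg_cst|exact: continuous_snd].
Qed.

(** By periodicity one period suffices, and over [[e, 1 - e]] it is compact. *)
Lemma displacement_bound (e : R) : 0 < e -> exists C,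
  forall z, e < z.1 < 1 - e -> `|displacement z| <= C.
Proof.
move=> e0; pose K : set (R * R) := `[e, 1 - e] `*` `[0, 1].
have Ks z : K z -> strip z.
  by move=> [/= +]; rewrite in_itv/= => /andP[? ?] _; apply/andP; split; lra.
have /compact_bounded[C [_ hC]] : compact (displacement @` K).
  apply: continuous_compact.
    apply/subspace_continuousP => z Kz; apply: cvg_within_filter.
    exact: continuous_displacement (Ks _ Kz).
  by apply: compact_setX; exact: segment_compact.
(* [compact_bounded] bounds by every number strictly above [C]. *)
exists (C + 1) => z ze; apply: hC; first by lra.
have sz : strip z by case/andP: ze => ? ?; apply/andP; split; lra.
rewrite -(displacement_int (- Num.floor z.2) sz).
exists (z.1, z.2 + (- Num.floor z.2)%:~R) => //.
have /andP[h1 h2] := real_floor_itv (num_real z.2).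
move: h2; rewrite intrD => h2.
by case/andP: ze => z1 z2; split; rewrite /= in_itv/= ?mulrNz; apply/andP; split; lra.
Qed.

Variable e : R.
Hypothesis e0 : 0 < e.
Hypothesis absorb : forall x, B x -> exists N : nat, \forall y \near x, B y ->
  forall n, (N <= n)%N -> e < (q (iter n f y)).1 < 1 - e.

Let u n z : R := (iter n F z).2 / d%:R ^+ n.

(** These increments are the terms of the series for [H], since the second coordinate of F(w) is d
    w_2 plus the displacement of w. *)
Let u_step n z : u n.+1 z - u n z = displacement (iter n F z) / d%:R ^+ n.+1.
Proof.
have d0 : d%:R != 0 :> R by rewrite pnatr_eq0 -lt0n ltnW.
rewrite /u /= /displacement exprS; field.
by rewrite expf_neq0// d0.
Qed.

(** From time [N] on, the orbits of all points near [z] stay where the displacement is at most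
    [C]. *)
Let u_near z : strip z -> exists C N, \forall w \near z,
  forall n, (N <= n)%N -> `|u n.+1 w - u n w| <= C / 2 ^+ n.+1.
Proof.
move=> sz; have [C hC] := displacement_bound e0.
have [N hN] := absorb (cover_in imp sz); exists C, N.
have nB : \forall w \near z, strip w.
  by apply: open_nbhs_nbhs; split => //; exact: open_strip.
have nN := continuous_cover contp sz hN.
have {}nN : \forall w \near z, B (pi w) ->
  forall n, (N <= n)%N -> e < (q (iter n f (pi w))).1 < 1 - e by exact: nN.
apply: filterS2 nB nN => w sw /(_ (cover_in imp sw)) h n Nn.
have := h n Nn; rewrite -iter_cover// (cover_q pK)/=; last exact: iter_strip.
move=> /hC hd; rewrite u_step normrM [X in _ * X]ger0_norm ?invr_ge0 ?exprn_ge0//.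
have C0 := le_trans (normr_ge0 _) hd.
apply: ler_pM; rewrite ?invr_ge0 ?exprn_ge0//.
(* This is where [d >= 2] enters: powers of [d] dominate the powers of 2 in the geometric bound. *)
rewrite lef_pV2 ?posrE ?exprn_gt0// ?ltr0n; last exact: ltnW.
by apply: lerXn2r; rewrite ?nnegrE// ler_nat.
Qed.

Let u_cvg z : strip z -> cvgn (u ^~ z).
Proof.
move=> sz; have [C [N h]] := u_near sz.
exact: geometric_step_cvg (nbhs_singleton h).
Qed.

Lemma exists_linearization : exists H : R * R -> R,
  [/\ forall z, strip z -> {for z, continuous H},
      forall z, strip z -> H (F z) = d%:R * H z &
      forall z, strip z -> H (z.1, z.2 + 1) = H z + 1].
Proof.
have d0 : d%:R != 0 :> R by rewrite pnatr_eq0 -lt0n ltnW.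
exists (fun z => limn (u ^~ z)); split => z sz.
- have [C [N h]] := u_near sz; apply: geometric_step_continuous h => n.
  have cu : {for z, continuous (fun w => (iter n F w).2)}.
    exact: (cvg_for (@continuous_iter_lift n z sz) (@continuous_snd R R _)).
  exact: (cvgM cu (@cvg_cst _ _ _ _ _)).
- apply: cvg_lim => //; have -> : u ^~ (F z) = fun n => d%:R * u n.+1 z.
    apply/funext => n; rewrite /u -iterSr /= exprS; field.
    by rewrite expf_neq0// d0.
  by apply: cvgM; [exact: cvg_cst|rewrite (cvg_shiftS (u ^~ z)); exact: u_cvg].
(* A unit shift of [z] moves the n-th iterate by d^n, which the division turns back into exactly
   1. *)
- apply: cvg_lim => //; have -> : u ^~ (z.1, z.2 + 1) = fun n => u n z + 1.
    apply/funext => n; rewrite /u iter_lift_shift//= natrX mulrDl divff//.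
    by rewrite expf_neq0.
  by apply: cvgD; [exact: u_cvg|exact: cvg_cst].
Qed.

End Linearization.

(** * Absorption by the attractor *)

Section Attractor.
Context {M : topologicalType} (f : M -> M) (L U : set M).
Hypothesis compM : compact [set: M].
Hypothesis hausM : hausdorff_space M.
Hypothesis contf : continuous f.
Hypothesis attrU : attracting_nbhd f L U.

Lemma continuous_iter n : continuous (iter n f).
Proof.
elim: n => [|n IHn]; first by move=> x; exact: cvg_id.
by move=> x; exact: (cvg_for (IHn x) (@contf _)).
Qed.

(** Compact stand-ins for the images of [U]: [K n] lies between the images of [U] under the iterates
    [n.+1] and [n], so both sequences have the same intersection. *)
Let K n := iter n f @` closure (f @` U).

Let compactK n : compact (K n).
Proof.
apply: continuous_compact; first exact/continuous_subspaceT/continuous_iter.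
apply: (subclosed_compact _ compM) => //; exact: closed_closure.
Qed.

Let subK n : iter n.+1 f @` U `<=` K n.
Proof.
move=> _ [x Ux <-]; rewrite iterSr; exists (f x) => //.
by apply: subset_closure; exists x.
Qed.

Let Ksub n : K n `<=` iter n f @` U.
Proof.
have [_ cU _] := attrU.
by move=> _ [x cx <-]; exists x => //; exact: cU.
Qed.

Let K_decr m n : (m <= n)%N -> K n `<=` K m.
Proof.
move=> /subnKC <-; elim: (n - m)%N => [|k IHk]; first by rewrite addn0.
apply: subset_trans IHk; rewrite addnS; apply: subset_trans (@Ksub _) _.
exact: subK.
Qed.

Let L_K : L = \bigcap_n K n.
Proof.
have [_ _ ->] := attrU; apply/seteqP; split => x hx n _.
  exact/subK/hx.
exact/Ksub/hx.
Qed.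

Lemma attractor_compact : compact L.
Proof.
apply: (subclosed_compact _ compM) => //; rewrite L_K.
by apply: closed_bigI => n _; exact: compact_closed.
Qed.

(** A point outside the interior of [W] is not in [L], hence misses some closed [K n], and so do its
    neighbors for all later indices. Compactness of the complement gives one common index. *)
Let K_sub_nbhs W : set_nbhs L W -> exists n, K n `<=` W.
Proof.
move=> LW; pose O := interior W; have oO : open O by exact: open_interior.
have LO : L `<=` O by move=> x /LW.
have /compact_near_coveringP cov : compact (~` O).
  by apply: (subclosed_compact _ compM) => //; exact: open_closedC.
have nK x : ~ O x -> \forall y \near x & n \near \oo, ~ K n y.
  move=> nOx; have [n nKx] : exists n, ~ K n x.
    apply: contrapT => /forallNP h; apply/nOx/LO; rewrite L_K => n _.
    exact: contrapT (h n).
  have nK : \forall y \near x, ~ K n y.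
    apply: open_nbhs_nbhs; split => //.
    by apply: closed_openC; exact: compact_closed.
  exists ([set y | ~ K n y], [set m | (n <= m)%N]).
    by split => //=; exact: nbhs_infty_ge.
  by move=> [y m] /= [nKy nm] Kmy; apply: nKy; exact: K_decr nm _ Kmy.
have [n _ /(_ n (leqnn n)) h] := cov nat \oo (fun n x => ~ K n x) _ nK.
exists n => y Ky; apply: (@interior_subset _ W).
by apply: contrapT => /h.
Qed.

Lemma basin_absorb W x : set_nbhs L W -> basin f L x ->
  exists N, \forall y \near x, forall n, (N <= n)%N -> W (iter n f y).
Proof.
move=> /K_sub_nbhs[k KW] bx; have [LU _ _] := attrU.
have : set_nbhs L (interior U).
  by move=> y /LU Uy; apply: open_nbhs_nbhs; split => //; exact: open_interior.
move=> /bx [m _ /(_ m (leqnn m)) /= Um].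
(* Being in the interior of [U] at time [m] is an open condition on the starting point. One step
   beyond [k] is added because [K k] contains the image of [U] under the iterate [k.+1]. *)
exists (m + k.+1)%N.
have : \forall y \near x, interior U (iter m f y).
  apply: (@continuous_iter m x); apply: open_nbhs_nbhs; split => //.
  exact: open_interior.
apply: filterS => y /interior_subset Uy n mn; apply: KW.
have [j ->] : exists j, n = (j + k.+1 + m)%N.
  by exists (n - (m + k.+1))%N; rewrite -addnA [(k.+1 + m)%N]addnC subnK.
rewrite iterD; apply: (@K_decr k (j + k)); first exact: leq_addl.
by apply: subK; exists (iter m f y) => //; rewrite addnS.
Qed.

Hypothesis fL : f @` L = L.

Lemma attractor_iter n x : L x -> L (iter n f x).
Proof. by move=> Lx; elim: n => //= n Ln; rewrite -fL; exists (iter n f x). Qed.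

Lemma attractor_basin : L `<=` basin f L.
Proof.
move=> x Lx W LW; apply: nearW => n.
exact: nbhs_singleton (LW _ (attractor_iter n Lx)).
Qed.

Lemma basin_stable x : basin f L x -> basin f L (f x).
Proof.
move=> bx W /bx [N _ h]; exists N => // n Nn /=.
by rewrite -iterSr; apply: h; exact: leqW.
Qed.

Lemma attractor_immediate : L `<=` immediate_basin f L.
Proof.
by move=> x Lx; exists x => //; apply: connected_component_refl; exact: attractor_basin.
Qed.

Lemma immediate_basin_sub : immediate_basin f L `<=` basin f L.
Proof. by move=> x [y _]; exact: connected_component_sub. Qed.

(** The image of the component of [y] in [L] is connected, stays in the basin and contains [f y],
    again a point of [L]. *)
Lemma immediate_basin_stable x : immediate_basin f L x -> immediate_basin f L (f x).
Proof.
move=> [y Ly yx]; have Lfy : L (f y) by rewrite -fL; exists y.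
exists (f y) => //.
have sub : f @` connected_component (basin f L) y `<=` basin f L.
  by move=> _ [z yz <-]; apply/basin_stable; exact: connected_component_sub yz.
have conn : connected (f @` connected_component (basin f L) y).
  apply: connected_continuous_connected; first exact: component_connected.
  exact: continuous_subspaceT.
apply: (connected_component_max _ sub conn); last by exists x.
by exists y => //; apply: connected_component_refl; exact: attractor_basin.
Qed.

End Attractor.

(** * The semiconjugacy *)

Section ChainMaps.
Context {R : realType} {X Y : topologicalType} (A : set X) (B : set Y).

Lemma chain_in_pushforward n (h : X -> Y) (c : chain R X n) :
  {within A, continuous h} -> (forall x, A x -> B (h x)) ->
  chain_in A c -> chain_in B (pushforward h c).
Proof.
move=> ch hB; move: c; apply: chain_in_ind => [|c c' Bc Bc'|k s cs As].
- by rewrite raddf0; exact: chain_in0.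
- by rewrite raddfD; exact: chain_inD.
rewrite pushforwardU; apply: chain_inU; first exact: within_continuous_compl ch cs As.
by move=> _ [x _ <-]; apply: hB; apply: As; exists x.
Qed.

Lemma homologous_pushforward n (h : X -> Y) (c c' : chain R X n) :
  {within A, continuous h} -> (forall x, A x -> B (h x)) ->
  homologous_in A c c' -> homologous_in B (pushforward h c) (pushforward h c').
Proof.
move=> ch hB [b Ab bE]; exists (pushforward h b); first exact: chain_in_pushforward Ab.
by rewrite -raddfB bE boundary_pushforward.
Qed.

Lemma cycle_pushforward n (h : X -> Y) (c : chain R X n.+1) :
  {within A, continuous h} -> (forall x, A x -> B (h x)) ->
  cycle_in A c -> cycle_in B (pushforward h c).
Proof.
move=> ch hB [Ac c0]; split; first exact: chain_in_pushforward Ac.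
by rewrite boundary_pushforward c0 raddf0.
Qed.

Lemma eq_pushforward_in n (h h' : X -> Y) (c : chain R X n) :
  chain_in A c -> (forall x, A x -> h x = h' x) ->
  pushforward h c = pushforward h' c.
Proof.
move=> + hh'; move: c; apply: chain_in_ind => [|c c' e e'|k s cs As].
- by rewrite !raddf0.
- by rewrite !raddfD /= e e'.
rewrite !pushforwardU; congr << _ *g _ >>; apply/funext => x /=.
by apply: hh'; apply: As; exists x.
Qed.

End ChainMaps.

Lemma pushforward_id {R : realType} (X : topologicalType) n (c : chain R X n) :
  pushforward id c = c.
Proof.
elim/freeg_ind_dom0: c => [|k s c _ _ IHc]; first by rewrite raddf0.
by rewrite raddfD /= IHc pushforwardU.
Qed.

(** If [h c] bounds, then [c], being homologous to [i (h c)], bounds as well; and [i c'] is a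
    preimage of the class of [c']. The equations hold only on [A] and [B], so [eq_pushforward_in]
    exchanges maps that agree there. *)
Lemma homotopy_equivalence_H1 {R : realType} (X Y : topologicalType)
    (A : set X) (B : set Y) (h : X -> Y) (i : Y -> X)
    (G : X * R -> X) (K : Y * R -> Y) :
  {within A, continuous h} -> (forall x, A x -> B (h x)) ->
  {within B, continuous i} -> (forall y, B y -> A (i y)) ->
  {within A `*` `[0, 1], continuous G} ->
  (forall x s, A x -> 0 <= s <= 1 -> A (G (x, s))) ->
  (forall x, A x -> G (x, 1) = x) ->
  (forall x, A x -> G (x, 0) = i (h x)) ->
  {within B `*` `[0, 1], continuous K} ->
  (forall y s, B y -> 0 <= s <= 1 -> B (K (y, s))) ->
  (forall y, B y -> K (y, 1) = y) ->
  (forall y, B y -> K (y, 0) = h (i y)) ->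
  H1_isomorphism R A B h.
Proof.
move=> ch hB ci iA cG GA G1 G0 cK KB K1 K0; split=> [c Ac h0|c' Bc'].
  have := homotopy_homologous cG GA Ac.
  rewrite (eq_pushforward_in (h' := id) Ac.1)//.
  rewrite (eq_pushforward_in (h := fun x => G (x, 0)) (h' := i \o h) Ac.1)//.
  rewrite pushforward_id pushforward_comp => /homologous_in_trans; apply.
  by rewrite -[0](raddf0 (pushforward i)); exact: homologous_pushforward h0.
exists (pushforward i c'); first exact: cycle_pushforward Bc'.
have := homotopy_homologous cK KB Bc'.
rewrite (eq_pushforward_in (h' := id) Bc'.1)//.
rewrite (eq_pushforward_in (h := fun y => K (y, 0)) (h' := h \o i) Bc'.1)//.
rewrite pushforward_id pushforward_comp; exact: homologous_in_sym.
Qed.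

Section LocalSections.
Context {R : realType}.

(** An arbitrary, discontinuous choice of logarithm. Whatever is built on it is periodic, and
    [local_clog] supplies continuous branches for proofs of continuity. *)
Definition clog (w : R * R) : R := xget 0 [set y | cexp y = w].

Lemma clogK w : circle w -> cexp (clog w) = w.
Proof. by move=> /cexp_surj h; exact: (xgetPex 0 h). Qed.

Lemma local_clog (w : R * R) : circle w -> exists s : R * R -> R,
  [/\ s w' @[w' --> w] --> s w, cexp (s w) = w &
      \forall w' \near w, circle w' -> cexp (s w') = w'].
Proof.
move=> cw; exists (fun w' => clog w + carg (cdiv w' w)).
have cd : cdiv w' w @[w' --> w] --> ((1, 0) : R * R).
  by rewrite -(cdivzz cw); apply: cvg_cdiv; [exact: cvg_id|exact: cvg_cst].
split.
- apply: cvgD; first exact: cvg_cst.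
  by rewrite cdivzz//; apply: (cvg_carg _ _ cd); rewrite /circle /= ?expr1n ?expr0n ?addr0.
- by rewrite cdivzz// carg1 addr0 clogK.
- have c0 : \forall w' \near w, 0 < (cdiv w' w).1.
    exact: (cvgr_gt _ (cvg_proj1 cd) _ ltr01).
  apply: filterS c0 => w' w'0 cw'.
  by apply: cexp_carg; rewrite ?clogK// ltW.
Qed.
(** [G] may be defined through a discontinuous section; it is enough that near [x] it factors
    through some section [s] continuous at [x], uniformly in the time. *)
Lemma within_cylinder_cvg (X V T : topologicalType) (A : set X) (I : set R)
    (G : X * R -> T) (s : X -> V) (g : V * R -> T) x r :
  s y @[y --> within A (nbhs x)] --> s x -> {for (s x, r), continuous g} ->
  A x -> G (x, r) = g (s x, r) ->
  (\forall y \near x, A y -> forall r', I r' -> G (y, r') = g (s y, r')) ->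
  G @ within (A `*` I) (nbhs (x, r)) --> G (x, r).
Proof.
move=> cs cg Ax Gx Gy.
have p1 : w.1 @[w --> within (A `*` I) (nbhs (x, r))] --> within A (nbhs x).
  move=> P nP; have nP1 : nbhs (x, r) [set w | A w.1 -> P w.1].
    exact: (@continuous_fst _ _ (x, r) _ nP).
  suff : nbhs (x, r) [set w | (A `*` I) w -> P w.1] by [].
  by apply: filterS nP1 => w /= h [Aw _]; exact: h.
have p2 : w.2 @[w --> within (A `*` I) (nbhs (x, r))] --> r.
  by apply: cvg_within_filter; exact: (@continuous_snd _ _ (x, r)).
have sp : s w.1 @[w --> within (A `*` I) (nbhs (x, r))] --> s x by exact: cvg_comp p1 cs.
suff : G w @[w --> within (A `*` I) (nbhs (x, r))] --> G (x, r) by [].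
rewrite Gx; apply: (@cvg_trans _ (g (s w.1, w.2) @[w --> within (A `*` I) (nbhs (x, r))])).
  apply: near_eq_cvg.
  have nG : nbhs (x, r) [set w | A w.1 -> forall r', I r' -> G (w.1, r') = g (s w.1, r')].
    exact: (@continuous_fst _ _ (x, r) _ Gy).
  suff : nbhs (x, r) [set w | (A `*` I) w -> g (s w.1, w.2) = G w] by [].
  by apply: filterS nG => -[y r'] /= h [/h hA /hA].
exact: (cvg_for (cvg_pair_nbhs sp p2) cg).
Qed.

End LocalSections.

(** * Descent from the strip and the homotopy inverse *)

Section Semiconjugacy.
Context {R : realType} {M : topologicalType} (B : set M).
Variables (p : R * (R * R) -> M) (q : M -> R * (R * R)).
Hypothesis contp : {within annulus, continuous p}.
Hypothesis imp : p @` annulus = B.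
Hypothesis contq : {within B, continuous q}.
Hypothesis pK : forall x, annulus x -> q (p x) = x.

Local Notation pi := (annulus_cover p).

Lemma cover_int (z : R * R) (m : int) : pi (z.1, z.2 + m%:~R) = pi z.
Proof. by rewrite /annulus_cover /= cexp_int. Qed.

Definition cover_section (x : M) : R * R := ((q x).1, clog (q x).2).

Local Notation sec := cover_section.

Lemma section_strip x : B x -> strip (sec x).
Proof. by move=> /(q_annulus imp pK)[+ _]; rewrite /= in_itv. Qed.

Lemma sectionK x : B x -> pi (sec x) = x.
Proof.
move=> Bx; have [_ q2] := q_annulus imp pK Bx.
by rewrite /annulus_cover /= clogK// -surjective_pairing (qK imp pK).
Qed.

Lemma section_cover z : strip z -> exists m : int, sec (pi z) = (z.1, z.2 + m%:~R).
Proof.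
move=> sz; rewrite /cover_section (cover_q pK sz) /=.
have [|m ->] := @cexp_inj R (clog (cexp z.2)) z.2; last by exists m.
exact/clogK/cexp_circle.
Qed.

Lemma local_section x : B x -> exists s : M -> R * R,
  [/\ s y @[y --> within B (nbhs x)] --> s x, strip (s x), pi (s x) = x &
      \forall y \near x, B y -> strip (s y) /\ pi (s y) = y].
Proof.
move=> Bx; have [q1 q2] := q_annulus imp pK Bx.
have [l [cl lx nl]] := local_clog q2.
have cq : q y @[y --> within B (nbhs x)] --> q x.
  by have /subspace_continuousP/(_ x Bx) := contq.
have cq2 : (q y).2 @[y --> within B (nbhs x)] --> (q x).2 by exact: cvg_proj2 cq.
exists (fun y => ((q y).1, l (q y).2)); split.
- exact: (cvg_pair_nbhs (cvg_proj1 cq) (cvg_for cq2 cl)).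
- by move: q1; rewrite /= in_itv.
- by rewrite /annulus_cover /= lx -surjective_pairing (qK imp pK).
- have := cq2 _ nl => h.
  have {}h : \forall y \near x, B y -> circle (q y).2 -> cexp (l (q y).2) = (q y).2.
    exact: h.
  apply: filterS h => y h By; have [qy1 qy2] := q_annulus imp pK By.
  split; first by move: qy1; rewrite /= in_itv.
  by rewrite /annulus_cover /= h// -surjective_pairing (qK imp pK).
Qed.

(** The projection from the strip has local sections, so continuity can be tested upstairs. *)
Lemma descend_continuous (T : topologicalType) (a : M -> T) (g : R * R -> T) :
  (forall z, strip z -> {for z, continuous g}) ->
  (forall z, strip z -> a (pi z) = g z) -> {within B, continuous a}.
Proof.
move=> cg ag; apply/subspace_continuousP => x Bx.
have [s [cs ss sK ns]] := local_section Bx.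
suff : a y @[y --> within B (nbhs x)] --> a x by [].
have -> : a x = g (s x) by rewrite -ag// sK.
apply: (@cvg_trans _ (g (s y) @[y --> within B (nbhs x)])).
  apply: near_eq_cvg.
  suff : nbhs x [set y | B y -> g (s y) = a y] by [].
  by apply: filterS ns => y h /h[sy {2}<-]; rewrite ag.
exact: (cvg_for cs (cg _ ss)).
Qed.

Lemma descend_cylinder_continuous (T : topologicalType) (a : M * R -> T)
    (g : (R * R) * R -> T) :
  (forall z r, strip z -> 0 <= r <= 1 -> {for (z, r), continuous g}) ->
  (forall z r, strip z -> a (pi z, r) = g (z, r)) ->
  {within B `*` `[0, 1], continuous a}.
Proof.
move=> cg ag; apply/subspace_continuousP => -[x r] [/= Bx]; rewrite in_itv/= => r01.
have [s [cs ss sK ns]] := local_section Bx.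
apply: (within_cylinder_cvg cs (cg _ _ ss r01)) => //; first by rewrite -ag// sK.
by apply: filterS ns => y h /h[sy yE] r' _; rewrite -ag// yE.
Qed.

Variable H : R * R -> R.
Hypothesis contH : forall z, strip z -> {for z, continuous H}.
Hypothesis HS : forall z, strip z -> H (z.1, z.2 + 1) = H z + 1.

Lemma H_int z (m : int) : strip z -> H (z.1, z.2 + m%:~R) = H z + m%:~R.
Proof.
have dn w n : strip w -> H (w.1, w.2 + n%:R) = H w + n%:R.
  move=> sw; elim: n => [|n IHn]; first by rewrite !addr0 -surjective_pairing.
  by rewrite -natr1 !addrA (HS (z := (w.1, _)))// IHn.
case: m => m sz; first exact: dn.
have := dn (z.1, z.2 + (Negz m)%:~R) m.+1 sz.
rewrite /= NegzE mulrNz subrK -surjective_pairing => ->.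
by rewrite addrK.
Qed.

Definition circle_map (x : M) : R * R := cexp (H (sec x)).

Lemma circle_mapE z : strip z -> circle_map (pi z) = cexp (H z).
Proof.
by move=> sz; rewrite /circle_map; have [m ->] := section_cover sz; rewrite H_int// cexp_int.
Qed.

Lemma continuous_circle_map : {within B, continuous circle_map}.
Proof.
apply: (descend_continuous (g := cexp \o H)) => z sz; last exact: circle_mapE.
exact: (cvg_for (contH sz) (@continuous_cexp R _)).
Qed.

Let strip_half (y : R) : strip (1 / 2 : R, y).
Proof. by rewrite /strip /=; apply/andP; split; lra. Qed.

Lemma circle_map_H1 : H1_isomorphism R B circle circle_map.
Proof.
pose i (w : R * R) := p (1 / 2 : R, w).
(* The segment from (1/2, H z) to [z]; its start projects to [i (circle_map x)]. *)
pose g (w : (R * R) * R) : R * R :=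
  ((1 - w.2) * (1 / 2) + w.2 * w.1.1, (1 - w.2) * H w.1 + w.2 * w.1.2).
pose G (w : M * R) := pi (g (sec w.1, w.2)).
(* The segment from H(1/2, y) to [y], whose start projects to [circle_map (i w)] for w = cexp y. *)
pose k (w : R * R) : R := (1 - w.2) * H (1 / 2, w.1) + w.2 * w.1.
pose K (w : (R * R) * R) := cexp (k (clog w.1, w.2)).
(* The weights [1 - r] and [r] add up to 1, and both [H] and the second coordinate shift by [m]
   under a deck transformation. So [g] commutes with it and [G] does not depend on the chosen
   section. *)
have GE z r : strip z -> G (pi z, r) = pi (g (z, r)).
  move=> sz; rewrite /G /=; have [m ->] := section_cover sz.
  rewrite /g /= H_int// -[RHS](cover_int _ m) /=.
  by congr (pi (_, _)); ring.
have gs z r : strip z -> 0 <= r <= 1 -> strip (g (z, r)).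
  case: z => x y; rewrite /strip /= => /andP[? ?] /andP[? ?].
  by apply/andP; split; nra.
have KE y r : K (cexp y, r) = cexp (k (y, r)).
  rewrite /K /=; have [|m ->] := @cexp_inj R (clog (cexp y)) y.
    exact/clogK/cexp_circle.
  rewrite /k /=; have -> := H_int m (strip_half y).
  rewrite -[RHS](cexp_int _ m); congr cexp; ring.
have i_ann (w : R * R) : circle w -> annulus (1 / 2 : R, w).
  by move=> cw; split=> //=; rewrite in_itv/=; apply/andP; split; lra.
have cg z r : strip z -> {for (z, r), continuous g}.
  move=> sz; have c1 : {for (z, r), continuous (fun w : (R * R) * R => w.1.1)}.
    exact: (continuous_total_comp (@continuous_fst _ _) (@continuous_fst _ _)).
  have c2 : {for (z, r), continuous (fun w : (R * R) * R => w.1.2)}.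
    exact: (continuous_total_comp (@continuous_fst _ _) (@continuous_snd _ _)).
  have cr : {for (z, r), continuous (fun w : (R * R) * R => w.2)}.
    exact: continuous_snd.
  have cr' : {for (z, r), continuous (fun w : (R * R) * R => 1 - w.2)}.
    by apply: cvgB => //; exact: cvg_cst.
  have cH : {for (z, r), continuous (fun w : (R * R) * R => H w.1)}.
    exact: (cvg_for (@continuous_fst _ _ (z, r)) (contH sz)).
  apply: cvg_pair_nbhs; last exact: (cvgD (cvgM cr' cH) (cvgM cr c2)).
  by apply: cvgD; [apply: cvgM => //; exact: cvg_cst|exact: cvgM].
have ck : continuous k.
  move=> [y r]; have cy : {for (y, r), continuous (fun w : R * R => w.1)}.
    exact: continuous_fst.
  have cr : {for (y, r), continuous (fun w : R * R => w.2)} by exact: continuous_snd.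
  have cr' : {for (y, r), continuous (fun w : R * R => 1 - w.2)}.
    by apply: cvgB => //; exact: cvg_cst.
  have cH : {for (y, r), continuous (fun w : R * R => H (1 / 2, w.1))}.
    have cpair : {for (y, r), continuous (fun w : R * R => (1 / 2 : R, w.1))}.
      by apply: cvg_pair_nbhs; [exact: cvg_cst|exact: cy].
    exact: (cvg_for cpair (contH (strip_half _))).
  exact: (cvgD (cvgM cr' cH) (cvgM cr cy)).
apply: (@homotopy_equivalence_H1 _ _ _ B circle circle_map i G K).
- exact: continuous_circle_map.
- by move=> x _; exact: cexp_circle.
- apply/subspace_continuousP => w cw.
  have /subspace_continuousP/(_ (1 / 2, w)) := contp => /(_ (i_ann _ cw)) hp P /hp hP.
  have cpair : continuous (fun w' : R * R => (1 / 2 : R, w')).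
    by apply: continuous_pairing; [exact: cst_continuous|move=> u; exact: cvg_id].
  have nP : nbhs w [set w' | annulus (1 / 2 : R, w') -> P (i w')] by exact: cpair hP.
  suff : nbhs w [set w' | circle w' -> P (i w')] by [].
  by apply: filterS nP => w' h /i_ann /h.
- by move=> w /i_ann aw; rewrite -imp; exists (1 / 2, w).
- apply: (descend_cylinder_continuous (g := pi \o g)) => z r sz; last exact: GE.
  move=> r01; exact: (cvg_for (cg _ _ sz) (continuous_cover contp (gs _ _ sz r01))).
- by move=> x r Bx r01; apply/(cover_in imp)/gs => //; exact: section_strip.
- move=> x Bx; rewrite -{1}(sectionK Bx) GE; last exact: section_strip.
  rewrite -[RHS](sectionK Bx) /g; move: (sec x) => [a b] /=.
  by congr (pi (_, _)); ring.
- move=> x Bx; rewrite -{1}(sectionK Bx) GE; last exact: section_strip.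
  by rewrite /g /i /annulus_cover /circle_map /=; congr (p (_, cexp _)); ring.
- apply/subspace_continuousP => -[w r] [/= cw]; rewrite in_itv/= => r01.
  have [l [cl lw nl]] := local_clog cw.
  have cl' : l w' @[w' --> within circle (nbhs w)] --> l w by exact: cvg_within_filter.
  apply: (within_cylinder_cvg cl' (g := cexp \o k)) => //.
  - exact: (cvg_for (ck _) (@continuous_cexp R _)).
  - by have := KE (l w) r; rewrite lw.
  - by apply: filterS nl => w' h /h e r' _; have := KE (l w') r'; rewrite e.
- by move=> y r _ _; exact: cexp_circle.
- move=> y cy; have := KE (clog y) 1; rewrite (clogK cy) => ->.
  by rewrite /k -[RHS](clogK cy) /=; congr cexp; ring.
- move=> y cy; have := KE (clog y) 0; rewrite (clogK cy) => ->.
  have -> : i y = pi (1 / 2, clog y) by rewrite /i /annulus_cover /= clogK.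
  by rewrite circle_mapE// /k /=; congr cexp; ring.
Qed.

End Semiconjugacy.

(** Compactness keeps [L] off both ends of the annulus, and the resulting smaller annulus absorbs
    orbits as any neighborhood of [L] does. Conditions take the form [B y -> ...] because [q] is
    continuous only relative to [B]. *)
Lemma annular_absorption {R : realType} {M : topologicalType} (f : M -> M)
    (L U : set M) (q : M -> R * (R * R)) :
  compact [set: M] -> hausdorff_space M -> continuous f ->
  attracting_nbhd f L U -> f @` L = L ->
  {within immediate_basin f L, continuous q} ->
  (forall x, immediate_basin f L x -> annulus (q x)) ->
  exists2 e : R, 0 < e & forall x, immediate_basin f L x ->
    exists N : nat, \forall y \near x, immediate_basin f L y ->
      forall n, (N <= n)%N -> e < (q (iter n f y)).1 < 1 - e.
Proof.
set B := immediate_basin f L; move=> compM hausM cf attrU fL contq qB.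
have LB : L `<=` B := attractor_immediate fL.
have cq1 x : B x -> (q y).1 @[y --> within B (nbhs x)] --> (q x).1.
  move=> Bx; have cq : q y @[y --> within B (nbhs x)] --> q x.
    by have /subspace_continuousP/(_ x Bx) := contq.
  exact: cvg_proj1 cq.
have nearq x a b : B x -> a < (q x).1 < b ->
    \forall y \near x, B y -> a < (q y).1 < b.
  move=> Bx /andP[ax xb].
  have na : \forall y \near within B (nbhs x), a < (q y).1 := cvgr_gt _ (cq1 _ Bx) _ ax.
  have nb : \forall y \near within B (nbhs x), (q y).1 < b := cvgr_lt _ (cq1 _ Bx) _ xb.
  have {}na : nbhs x [set y | B y -> a < (q y).1] by exact: na.
  have {}nb : nbhs x [set y | B y -> (q y).1 < b] by exact: nb.
  by apply: filterS2 na nb => y ha hb By; rewrite ha// hb.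
have [e e0 Le] : exists2 e : R, 0 < e & forall x, L x -> e < (q x).1 < 1 - e.
  have /compact_near_coveringP cov := attractor_compact compM hausM cf attrU.
  have h x : L x -> \forall y \near x & e \near (0 : R)^'+, B y -> e < (q y).1 < 1 - e.
    move=> Lx; have [+ _] := qB _ (LB _ Lx); rewrite /= in_itv/= => /andP[q0 q1].
    (* Half the distance to the nearer end: points near [x] keep distance [m], so every [e] below
       [m] works for all of them. *)
    pose m := Num.min (q x).1 (1 - (q x).1) / 2.
    have m0 : 0 < m by rewrite divr_gt0// lt_min q0 subr_gt0.
    have [m1 m2] : m < (q x).1 /\ m < 1 - (q x).1.
      have : Num.min (q x).1 (1 - (q x).1) <= (q x).1 by rewrite ge_min lexx.
      have : Num.min (q x).1 (1 - (q x).1) <= 1 - (q x).1 by rewrite ge_min lexx orbT.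
      by move: m0; rewrite /m => *; split; lra.
    exists ([set y | B y -> m < (q y).1 < 1 - m], [set e | e < m]).
      split => /=; last exact: nbhs_right_lt.
      by apply: nearq; [exact: LB|apply/andP; split; lra].
    by move=> [y e] /= [hy em] /hy/andP[? ?]; apply/andP; split; lra.
  have ne := cov _ _ _ _ h.
  have [e [/= e0 he]] : exists e : R, 0 < e /\ L `<=` (fun y => B y -> e < (q y).1 < 1 - e).
    have : \forall e \near (0 : R)^'+,
      0 < e /\ L `<=` (fun y => B y -> e < (q y).1 < 1 - e).
      by near=> e; split; near: e; [exact: nbhs_right_gt|exact: ne].
    by move=> /filter_ex.
  by exists e => // x Lx; apply: he => //; exact: LB.
exists e => // x Bx.
have nW : set_nbhs L [set y | B y -> e < (q y).1 < 1 - e].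
  by move=> y Ly; apply: nearq; [exact: LB|exact: Le].
have [N hN] := basin_absorb compM hausM cf attrU nW (immediate_basin_sub Bx).
exists N; apply: filterS hN => y hy By n Nn; apply: hy => //.
by elim: n {Nn} => //= n; exact: immediate_basin_stable.
Unshelve. all: by end_near. Qed.

Lemma annular_semiconjugacy {R : realType} {M : topologicalType} (f : M -> M)
    (L : set M) (d : nat) (p : R * (R * R) -> M) :
  compact [set: M] -> hausdorff_space M -> continuous f ->
  normal_attractor f L -> (1 < d)%N ->
  H1_multiplication R (immediate_basin f L) f d ->
  homeomorphism annulus (immediate_basin f L) p ->
  attractor_semiconjugate p f L d /\ basin_semiconjugate R f L d.
Proof.
move=> compM hausM cf [_ [U attrU _] [_ fL _]] d1 degf [contp imp [q contq pK]].
set B := immediate_basin f L in degf imp contq.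
have LB : L `<=` B := attractor_immediate fL.
have fB x : B x -> B (f x) by exact: immediate_basin_stable.
have [t contt tE] := exists_lift contp imp contq pK cf fB.
have tS := lift_degree contp imp contq pK degf contt tE.
have [e e0 absorb] := annular_absorption compM hausM cf attrU fL contq (q_annulus imp pK).
have [H [contH HF HS]] :=
  exists_linearization contp imp contq pK cf fB d1 contt tE tS e0 absorb.
pose h := circle_map q H.
have hE := circle_mapE pK HS.
have hc x : circle (h x) by exact: cexp_circle.
have hf x : B x -> h (f x) = cpow d (h x).
  move=> /(cover_surj imp pK)[z sz <-].
  rewrite -(cover_lift_semiconj imp pK fB tE sz) /h.
  rewrite !hE ?cpow_cexp ?HF//.
  exact: (strip_lift_closed imp pK fB t sz).
have ch : {within B, continuous h} := continuous_circle_map imp contq pK contH HS.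
have cover_strip z : cover_preimage p L z -> strip z by move=> [].
split.
  exists h, H; split.
  - by split => //; exact: continuous_subspaceW LB ch.
  - by move=> x /LB; exact: hf.
  - apply/subspace_continuousP => z /cover_strip sz.
    by apply: cvg_within_filter; exact: contH.
  - by move=> z /cover_strip; exact: hE.
  (* The sign is positive for every [p], since [H] is built in the coordinates of that same [p]. *)
  - by exists false => z /cover_strip sz; rewrite expr0; exact: HS.
exists h; split => //; exact: circle_map_H1.
Qed.

Theorem theorem2 (R : realType) (M : topologicalType) (f : M -> M)
    (L : set M) (d : nat)
    (surfM : compact_surface R M)
    (cont_f : continuous f)
    (normalL : normal_attractor f L)
    (d_gt1 : (1 < d)%N)
    (degL : attractor_degree R f L d)
    (no_crit : forall x, closure (basin f L) x -> ~ critical_point f x) :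
  (forall p : R * (R * R) -> M,
     homeomorphism (@annulus R) (immediate_basin f L) p ->
     attractor_semiconjugate p f L d) /\
  basin_semiconjugate R f L d.
Proof.
have [compM hausM _ _] := surfM; have [[p hp] degf] := degL.
(* The degree condition on homology does not mention [p], so this holds for every identification;
   the second claim uses the one contained in [degL]. *)
have main := annular_semiconjugacy compM hausM cont_f normalL d_gt1 degf.
by split=> [p' /main[]//|]; have [] := main p hp.
Qed.
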